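(* Let $(E,f,S)$ be an almost entropic partial Dowling geometry of rank $3$. Then there exists an almost entropic partial Dowling geometry $(\tilde{E},\tilde{f},S)$ of rank $4$, on the same generating set $S$ (with the same involution and distinguished element), such that $(\tilde E,\tilde f)$ extends $(E,f)$, i.e. $E\subseteq\tilde E$ and $\tilde f\restriction_{\mathcal{P}(E)}=f$, with the elements $b_1,b_2,b_3$ and $s_{i,j}$ ($s\in S$, $1\le i,j\le3$) of $E$ being the corresponding elements of $\tilde E$.
   Context: A polymatroid is $(E,f)$ with $f:\mathcal{P}(E)\to\mathbb{R}$, $f(\emptyset)=0$, monotone, submodular (and of finite type, $f(S)=\sup_{F\subseteq S\text{ finite}}f(F)$, if $E$ is infinite); $f(a_1,\dots,a_k):=f(\{a_1,\dots,a_k\})$ and $\mathrm{cl}(A)=\{x\in E\mid f(A\cup\{x\})=f(A)\}$. A polymatroid is entropic if $f(S)=H((X_i)_{i\in S})$ for random variables $(X_i)_{i\in E}$ on a finite probability space (Shannon entropy), and almost entropic if it is of finite type and a pointwise limit of entropic polymatroids on $E$. A partial Dowling geometry (PDG) of rank $r$ is a triple $(E,f,S)$ where $(E,f)$ is a polymatroid and: (1) $S$ is a set with an involution $s\mapsto s^{-1}$ and a distinguished element $e$ with $e^{-1}=e$; (2) $E$ contains $B=\{b_1,\ldots,b_r\}$ with $f(A)=|A|$ for all $A\subseteq B$; (3) for each $1\le i<j\le r$, $E$ contains a copy $\{s_{i,j}\mid s\in S\}$ of $S$, these copies pairwise disjoint and disjoint from $B$, and $E=B\sqcup\bigsqcup_{i<j}\{s_{i,j}\mid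 s\in S\}$; one sets $s_{i,j}^{-1}:=(s^{-1})_{i,j}$, and for $i<j$, $s_{j,i}:=s_{i,j}^{-1}$ and $s_{j,i}^{-1}:=s_{i,j}$; (4) $s_{i,j}\in\mathrm{cl}(b_i,b_j)$ for all distinct $i,j$; (5) $f(s_{i,j})=1$ and $f(b_i,s_{i,j})=2$ for all $s\in S$ and distinct $i,j$; (6) $f(s_{i,j},s^{-1}_{j,k},e_{k,i})=2$ for all $s\in S$ and distinct $i,j,k$. The PDG is almost entropic if $(E,f)$ is. *)

(* Defs.v *)
From HB Require Import structures.
From mathcomp Require Import all_boot all_order all_algebra.
From mathcomp Require Import all_classical all_reals all_analysis.

Set Implicit Arguments.
Unset Strict Implicit.
Unset Printing Implicit Defensive.

Import Order.TTheory GRing.Theory Num.Theory.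
Import numFieldNormedType.Exports.

Local Open Scope classical_set_scope.
Local Open Scope ring_scope.

Section Polymatroid.
Context {R : realType} {E : Type}.
Implicit Types (f g : set E -> R) (A B : set E).

Definition finite_type f : Prop :=
  forall A, f A = sup (f @` [set F | finite_set F /\ F `<=` A]).

(* For finite E the last field follows from monotonicity (take F := A), so it
   is required unconditionally. *)
Record polymatroid f : Prop := Polymatroid {
  polymatroid_set0 : f set0 = 0;
  polymatroid_mono : forall A B, A `<=` B -> f A <= f B;
  polymatroid_submod : forall A B, f (A `|` B) + f (A `&` B) <= f A + f B;
  polymatroid_finite_type : finite_type f
}.

Definition cl f A : set E := [set x | f (A `|` [set x]) = f A].

End Polymatroid.

Section Entropy.
Context {R : realType}.

Definition is_pmf (Omega : finType) (p : Omega -> R) : Prop :=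
  (forall w, 0 <= p w) /\ \sum_w p w = 1.

Definition law (Omega : finType) (p : Omega -> R) (V : choiceType)
  (Y : Omega -> V) (y : V) : R := \sum_(w | Y w == y) p w.

(* The logarithm is natural. The set of almost entropic polymatroids is a
   convex cone, so the notion does not depend on the base. *)
Definition entropy (Omega : finType) (p : Omega -> R) (V : choiceType)
  (Y : Omega -> V) : R :=
  - \sum_(y \in range Y) law p Y y * ln (law p Y y).

Definition joint (E : Type) (Omega : Type) (V : E -> choiceType)
  (X : forall i, Omega -> V i) (A : set E) :
  Omega -> (forall i : A, V (val i)) := fun w i => X (val i) w.

Definition entropic (E : Type) (f : set E -> R) : Prop :=
  exists (Omega : finType) (p : Omega -> R) (V : E -> choiceType)
    (X : forall i, Omega -> V i),
    is_pmf p /\ forall A : set E, f A = entropy p (joint X (A := A)).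

(* Pointwise limits are taken along arbitrary proper filters (equivalently,
   nets), because E may be uncountable. For countable E and f of finite type,
   limits of sequences give the same notion. *)
Definition almost_entropic (E : Type) (f : set E -> R) : Prop :=
  finite_type f /\
  exists (I : Type) (F : set_system I) (g : I -> set E -> R),
    [/\ ProperFilter F,
        forall i, entropic (g i) &
        forall A : set E, g i A @[i --> F] --> f A].

End Entropy.

Record genSet := GenSet {
  gen_sort :> Type;
  gen_inv : gen_sort -> gen_sort;
  gen_e : gen_sort;
  gen_invK : involutive gen_inv;
  gen_inv_e : gen_inv gen_e = gen_e
}.

(* c i j s is only meaningful for i < j; the value of dowling_elt at i = j is
   junk. Since gen_inv is an involution, the element s_{i,j}^{-1} is
   dowling_elt c i j (gen_inv s) for i < j as well as for j < i. *)
Definition dowling_elt (S : genSet) (r : nat) (E : Type)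
  (c : 'I_r -> 'I_r -> S -> E) (i j : 'I_r) (s : S) : E :=
  if (i < j)%N then c i j s else c j i (gen_inv s).

Record PDG (R : realType) (S : genSet) (r : nat) := MkPDG {
  pdg_ground :> Type;
  pdg_f : set pdg_ground -> R;
  pdg_b : 'I_r -> pdg_ground;
  pdg_copy : 'I_r -> 'I_r -> S -> pdg_ground;
  pdg_s := dowling_elt pdg_copy;
  pdg_polymatroid : polymatroid pdg_f;
  pdg_b_inj : injective pdg_b;
  pdg_b_free : forall A : {set 'I_r}, pdg_f (pdg_b @` [set` A]) = #|A|%:R;
  pdg_copy_inj : forall (i j k l : 'I_r) (s t : S), (i < j)%N -> (k < l)%N ->
    pdg_copy i j s = pdg_copy k l t -> [/\ i = k, j = l & s = t];
  pdg_copy_b : forall (i j k : 'I_r) (s : S), (i < j)%N ->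
    pdg_copy i j s <> pdg_b k;
  pdg_cover : forall x : pdg_ground, (exists i, x = pdg_b i) \/
    (exists (i j : 'I_r) (s : S), (i < j)%N /\ x = pdg_copy i j s);
  pdg_s_cl : forall (i j : 'I_r) (s : S), i != j ->
    cl pdg_f [set pdg_b i; pdg_b j] (pdg_s i j s);
  pdg_s_rank : forall (i j : 'I_r) (s : S), i != j ->
    pdg_f [set pdg_s i j s] = 1;
  pdg_bs_rank : forall (i j : 'I_r) (s : S), i != j ->
    pdg_f [set pdg_b i; pdg_s i j s] = 2;
  pdg_triangle : forall (i j k : 'I_r) (s : S), i != j -> j != k -> i != k ->
    pdg_f [set pdg_s i j s; pdg_s j k (gen_inv s); pdg_s k i (gen_e S)] = 2
}.

Definition pdg_extends (R : realType) (S : genSet) (m n : nat) (le_mn : (m <= n)%N)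
  (P : PDG R S m) (Q : PDG R S n) : Prop :=
  exists iota : P -> Q,
    [/\ injective iota,
        forall A : set P, pdg_f (iota @` A) = pdg_f A,
        forall i, iota (pdg_b P i) = pdg_b Q (widen_ord le_mn i) &
        forall (i j : 'I_m) (s : S), i != j ->
          iota (pdg_s P i j s) =
          pdg_s Q (widen_ord le_mn i) (widen_ord le_mn j) s].

(* Main.v *)
Require Import Defs.
From mathcomp Require Import all_boot all_order all_algebra.
From mathcomp Require Import all_classical all_reals all_analysis.
From mathcomp Require Import ring lra.

(* Write b1, b2, b3 for the basis of the given geometry. In the limit of entropic
   functions one may copy b3 together with the elements joining it to b1 and b2,
   conditionally independently over the line b1 b2; the copy is b4, and only the
   elements s34 are missing. A second copy, of b2 over the lines b1 b3 and b1 b4,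
   gives b5 with all elements s15, s35, s45. Contracting e45 (conditioning on it)
   does not change the rank on b1, ..., b4, makes b5 parallel to b4 and s15
   parallel to s14, so that s35 can serve as s34. The planes 123, 124, 134 are then
   copies of the given geometry, and the triangles in 234 follow from those in the
   other three faces of the tetrahedron by submodularity.
   Conditional entropies are mixtures of entropies, and the closure of the entropic
   functions is a convex cone, hence it is stable under contraction. Values on
   infinite sets are finally replaced by suprema over finite subsets. *)

Set Implicit Arguments.
Unset Strict Implicit.
Unset Printing Implicit Defensive.

Import Order.TTheory GRing.Theory Num.Theory.
Import numFieldNormedType.Exports.

Local Open Scope classical_set_scope.
Local Open Scope ring_scope.

(** * Entropy of a kernel *)

(** A conditionally independent copy is joined only to what is kept fixed, so b4, being free of b3,
    obtains no elements joining it to b3. The second copy gets around this: b2 already has lines to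
    both b3 and b4, and b5 inherits them.

    A copy is constructed from an honest distribution, hence for the entropic approximants and not
    for their limit. The values on either copy and the total value are linear in the old values and
    so pass to the limit. All other values of the copies are merely bounded; an ultrafilter makes
    them converge together.

    Random variables enter only through the partitions into their fibres, and these are handled as
    equivalence relations on the probability space. *)

Definition eqv (T : Type) (r : rel T) : Prop :=
  [/\ reflexive r, symmetric r & transitive r].

Lemma eqv_trans_eq (T : Type) (r : rel T) (x y z : T) :
  eqv r -> r x y -> r x z = r y z.
Proof.
move=> [_ rS rT] xy; apply/idP/idP; last exact: rT.
by apply: rT; rewrite rS.
Qed.

Lemma eqv_andb (T : Type) (r s : rel T) :
  eqv r -> eqv s -> eqv (fun x y => r x y && s x y).
Proof.
move=> [rR rS rT] [sR sS sT]; split => [x|x y|y x z]; first by rewrite rR sR.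
  by rewrite rS sS.
move=> /andP[ra sa] /andP[rb sb]; apply/andP.
by split; [exact: rT ra rb|exact: sT sa sb].
Qed.

Lemma eqv_comp (T U : Type) (h : U -> T) (r : rel T) :
  eqv r -> eqv (fun x y => r (h x) (h y)).
Proof. by move=> [rR rS rT]; split => [x|x y|y x z] //; exact: rT. Qed.

Section KernelEntropy.
Context {R : realType}.
Implicit Types Omega : finType.

Definition mass Omega (p : Omega -> R) (r : rel Omega) (w : Omega) : R :=
  \sum_(u | r w u) p u.

(** Summing over points instead of values turns the inequalities between entropies into inequalities
    pointwise in [w]. *)
Definition ker_entropy Omega (p : Omega -> R) (r : rel Omega) : R :=
  - \sum_w p w * ln (mass p r w).

Definition ker_of (E : Type) Omega (K : E -> rel Omega) (A : set E) : rel Omega :=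
  fun w u => `[< forall i, A i -> K i w u >].

Lemma eqv_ker_of (E : Type) Omega (K : E -> rel Omega) (A : set E) :
  (forall i, eqv (K i)) -> eqv (ker_of K A).
Proof.
move=> eK; split => [x|x y|y x z].
- by apply/asboolP => i _; have [] := eK i.
- by apply/asboolP/asboolP => h i Ai; have [_ ->] := eK i; move=> // _; exact: h.
- move=> /asboolP h1 /asboolP h2; apply/asboolP => i Ai.
  by have [_ _ t] := eK i; apply: t (h1 _ Ai) (h2 _ Ai).
Qed.

Lemma ker_ofU (E : Type) Omega (K : E -> rel Omega) (A B : set E) w u :
  ker_of K (A `|` B) w u = ker_of K A w u && ker_of K B w u.
Proof.
apply/asboolP/andP => [h|[/asboolP h1 /asboolP h2] i [/h1//|/h2//]].
by split; apply/asboolP => i ?; apply: h; [left|right].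
Qed.

Lemma ker_ofS (E : Type) Omega (K : E -> rel Omega) (A B : set E) :
  A `<=` B -> subrel (ker_of K B) (ker_of K A).
Proof. by move=> AB w u /asboolP h; apply/asboolP => i /AB; exact: h. Qed.

Lemma ker_of_image (E E' : Type) Omega (K : E' -> rel Omega) (h : E -> E')
    (A : set E) w u :
  ker_of K (h @` A) w u = ker_of (fun i => K (h i)) A w u.
Proof.
apply/asboolP/asboolP => H i; first by move=> Ai; apply: H; exists i.
by move=> [j Aj <-]; exact: H.
Qed.

(** Only the support counts. This matters because the two coordinates of a copy agree on the fixed
    variables only almost surely. *)
Lemma eq_ker_entropy Omega (p : Omega -> R) (r s : rel Omega) :
  (forall w u, p w != 0 -> p u != 0 -> r w u = s w u) ->
  ker_entropy p r = ker_entropy p s.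
Proof.
move=> rs; congr (- _); apply: eq_bigr => w _.
have [->|pw] := eqVneq (p w) 0; first by rewrite !mul0r.
congr (_ * ln _); rewrite /mass big_mkcond [RHS]big_mkcond /=.
apply: eq_bigr => u _; have [->|pu] := eqVneq (p u) 0; first by rewrite !if_same.
by rewrite rs.
Qed.

Lemma entropy_ker_entropy Omega (p : Omega -> R) (V : choiceType)
    (Y : Omega -> V) :
  entropy p Y = ker_entropy p (fun w u => Y w == Y u).
Proof.
rewrite /entropy /ker_entropy; congr (- _).
have finY : finite_set (range Y) by apply: finite_image; exact: finite_finset.
rewrite fsbig_finite //=.
under eq_bigr => y _ do rewrite {1}/law mulr_suml big_mkcond /=.
rewrite exchange_big /=; apply: eq_bigr => w _.
rewrite -big_mkcond /=; under eq_bigl do rewrite eq_sym.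
rewrite (finmap.fbig_pred1_inj (k := id)) //=.
  by congr (_ * ln _); apply: eq_bigl => u; rewrite eq_sym.
by rewrite in_fset_set// inE; exists w.
Qed.

Lemma entropicP (E : Type) (g : set E -> R) :
  entropic g <-> exists (Omega : finType) (p : Omega -> R) (K : E -> rel Omega),
    [/\ is_pmf p, forall i, eqv (K i) &
        forall A, g A = ker_entropy p (ker_of K A)].
Proof.
split=> [[W [p [V [X [hp gE]]]]]|[W [p [K [hp eK gE]]]]].
  exists W, p, (fun i w u => X i w == X i u); split => // [i|A].
    split => [x|x y|y x z]; [exact: eqxx|by rewrite eq_sym|].
    by move=> /eqP -> /eqP ->.
  rewrite gE entropy_ker_entropy; apply: eq_ker_entropy => w u _ _.
  apply/eqP/asboolP => [h i Ai|h].
    have /(congr1 (fun k => k (SigSub (mem_set Ai)))) := h.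
    by rewrite /joint /= => ->.
  by apply: functional_extensionality_dep => -[i Ai]; apply/eqP/h; apply: set_mem.
(* A kernel is realized by the variable that sends a point to the indicator function of its
   class. *)
exists W, p, (fun _ => {ffun W -> bool}), (fun i w => [ffun u => K i w u]).
split => // A; rewrite gE entropy_ker_entropy; apply: eq_ker_entropy => w u _ _.
apply/asboolP/eqP => [h|h i Ai].
  apply: functional_extensionality_dep => -[i Ai]; rewrite /joint /=.
  apply/ffunP => v; rewrite !ffunE; apply: eqv_trans_eq => //.
  by apply: h; apply: set_mem.
have /(congr1 (fun k => k (SigSub (mem_set Ai)))) := h.
rewrite /joint /= => /ffunP/(_ u); rewrite !ffunE => ->.
by have [-> _ _] := eK i.
Qed.

End KernelEntropy.

(** * Shannon inequalities and first operations on entropic functions *)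

Section Shannon.
Context {R : realType}.
Implicit Types Omega : finType.

Lemma ln_le_subr1 (x : R) : 0 < x -> ln x <= x - 1.
Proof.
move=> x0; have {1}-> : x = 1 + (x - 1) by ring.
by apply: le_ln1Dx; lra.
Qed.

Lemma mass_ge_self Omega (p : Omega -> R) (r : rel Omega) w :
  is_pmf p -> reflexive r -> p w <= mass p r w.
Proof.
move=> [p0 _] rR; rewrite /mass (bigD1 w) //= lerDl.
by apply: sumr_ge0 => u _; exact: p0.
Qed.

Lemma mass_gt0 Omega (p : Omega -> R) (r : rel Omega) w :
  is_pmf p -> reflexive r -> p w != 0 -> 0 < mass p r w.
Proof.
move=> hp rR pw; apply: lt_le_trans (mass_ge_self w hp rR).
by rewrite lt0r pw; have [-> _] := hp.
Qed.

Lemma mass_ge0 Omega (p : Omega -> R) (r : rel Omega) w :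
  is_pmf p -> 0 <= mass p r w.
Proof. by move=> [p0 _]; apply: sumr_ge0 => u _; exact: p0. Qed.

Lemma mass_le Omega (p : Omega -> R) (r s : rel Omega) w :
  is_pmf p -> subrel r s -> mass p r w <= mass p s w.
Proof.
move=> [p0 _] rs; rewrite /mass big_mkcond [leRHS]big_mkcond /=.
apply: ler_sum => u _; case: ifPn => [/rs -> //|_].
by case: ifP.
Qed.

Lemma mass_eqv Omega (p : Omega -> R) (r : rel Omega) w u :
  eqv r -> r w u -> mass p r w = mass p r u.
Proof. by move=> er wu; apply: eq_bigl => v; exact: eqv_trans_eq. Qed.

Lemma le_ker_entropy Omega (p : Omega -> R) (r s : rel Omega) :
  is_pmf p -> reflexive r -> subrel r s -> ker_entropy p s <= ker_entropy p r.
Proof.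
move=> hp rR rs; rewrite lerN2; apply: ler_sum => w _.
have [->|pw] := eqVneq (p w) 0; first by rewrite !mul0r.
have [p0 _] := hp; apply: ler_wpM2l => //.
have m0 := mass_gt0 hp rR pw; have mm := mass_le w hp rs.
by rewrite ler_ln// posrE// (lt_le_trans m0).
Qed.

(** Expand the masses of [rA] and [rB] into sums over [u] and [v]. For fixed [u], [v] the remaining
    [w] form one class of the meet or none, so the weights [p w / d w] add up to at most 1. They
    occur only if [u] and [v] share an [rC]-class, whose mass [c u] then cancels. *)
Lemma submod_aux Omega (p : Omega -> R) (rA rB rC : rel Omega) :
  is_pmf p -> eqv rA -> eqv rB -> eqv rC -> subrel rA rC -> subrel rB rC ->
  \sum_w p w * (mass p rA w * mass p rB w /
     (mass p (fun x y => rA x y && rB x y) w * mass p rC w)) <= 1.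
Proof.
move=> hp eA eB eC AC BC; have [p0 p1] := hp.
set d := mass p (fun _ _ => _ && _); set c := mass p rC.
have eD := eqv_andb eA eB.
have c0 w : 0 <= c w by exact: mass_ge0.
have d0 w : 0 <= d w by exact: mass_ge0.
rewrite [leLHS](_ : _ = \sum_u \sum_v p u * p v *
    \sum_(w | rA w u && rB w v) p w / (d w * c w)); last first.
  under eq_bigr => w _.
    rewrite -mulrA mulrCA [mass p rA w]big_mkcond /= mulr_suml.
    over.
  rewrite exchange_big /=; apply: eq_bigr => u _.
  rewrite [RHS](_ : _ = \sum_v \sum_w (if rA w u && rB w v then
     p u * p v * (p w / (d w * c w)) else 0)); last first.
    by apply: eq_bigr => v _; rewrite mulr_sumr big_mkcond.
  rewrite exchange_big /=; apply: eq_bigr => w _.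
  case: (rA w u); last by rewrite mul0r big1.
  rewrite /= -big_mkcond /= [mass p rB w]/mass.
  rewrite mulrCA !mulr_suml !mulr_sumr; apply: eq_bigr => v _; ring.
have inner u v : \sum_(w | rA w u && rB w v) p w / (d w * c w) <=
    (if rC u v then (c u)^-1 else 0).
  case: (pickP (fun w => rA w u && rB w v)) => [w0 /andP[au bv]|none]; last first.
    by rewrite big_pred0//; case: ifP => //; rewrite invr_ge0.
  have uv : rC u v.
    by rewrite -(eqv_trans_eq v eC (AC _ _ au)); exact: BC.
  rewrite uv [leLHS](_ : _ = d w0 / (d w0 * c u)).
    have [->|dn0] := eqVneq (d w0) 0; first by rewrite mul0r invr_ge0.
    by rewrite invfM mulrA divff// mul1r.
  have eqc w : rA w u && rB w v = (rA w0 w && rB w0 w).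
    rewrite (eqv_trans_eq w eA au) (eqv_trans_eq w eB bv).
    by have [_ -> _] := eA; have [_ -> _] := eB.
  rewrite {2}/d /mass mulr_suml; apply: eq_big => // w h.
  move: (h); rewrite eqc => h'.
  have -> : d w0 = d w by exact: mass_eqv.
  congr (_ / (_ * _)).
  by apply: mass_eqv => //; apply: AC; case/andP: h.
apply: (@le_trans _ _ (\sum_u \sum_v p u * p v *
    (if rC u v then (c u)^-1 else 0))).
  by apply: ler_sum => u _; apply: ler_sum => v _; apply: ler_wpM2l => //;
    exact: mulr_ge0.
rewrite -p1; apply: ler_sum => u _.
rewrite [leLHS](_ : _ = p u * (c u / c u)).
  have [->|cn0] := eqVneq (c u) 0; first by rewrite mul0r mulr0.
  by rewrite divff// mulr1.
rewrite {1}/c /mass mulr_suml mulr_sumr [RHS]big_mkcond /=; apply: eq_bigr => v _.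
by case: ifP => _; rewrite ?mulr0// mulrA.
Qed.

(** Conditional mutual information is nonnegative: [ln x <= x - 1] bounds the expected logarithm by
    the average of [submod_aux] minus 1. Here [rC] is any relation coarser than both, since the
    kernel of an intersection of index sets need not be generated by the two kernels. *)
Lemma ker_entropy_submod Omega (p : Omega -> R) (rA rB rC : rel Omega) :
  is_pmf p -> eqv rA -> eqv rB -> eqv rC -> subrel rA rC -> subrel rB rC ->
  ker_entropy p (fun x y => rA x y && rB x y) + ker_entropy p rC <=
  ker_entropy p rA + ker_entropy p rB.
Proof.
move=> hp eA eB eC AC BC; have [p0 p1] := hp.
have aux := submod_aux hp eA eB eC AC BC.
have eD := eqv_andb eA eB.
rewrite -!opprD lerN2 -!big_split /= -subr_le0 -sumrB.
apply: le_trans (_ : \sum_w p w * (mass p rA w * mass p rB w /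
     (mass p (fun x y => rA x y && rB x y) w * mass p rC w)) - \sum_w p w <= 0);
  last by rewrite p1 subr_le0.
rewrite -sumrB; apply: ler_sum => w _.
have [->|pw] := eqVneq (p w) 0; first by rewrite !mul0r !addr0 !subrr.
have [[rRA _ _] [rRB _ _]] := (eA, eB); have [[rRC _ _] [rRD _ _]] := (eC, eD).
have a0 := mass_gt0 hp rRA pw; have b0 := mass_gt0 hp rRB pw.
have c0 := mass_gt0 hp rRC pw; have d0 := mass_gt0 hp rRD pw.
rewrite -!mulrDr -mulrBr -[X in _ <= _ - X]mulr1 -mulrBr; apply: ler_wpM2l => //.
rewrite -!lnM ?posrE// -ln_div ?posrE ?mulr_gt0//.
by apply: ln_le_subr1; rewrite divr_gt0// mulr_gt0.
Qed.

Lemma entropic_mono (E : Type) (g : set E -> R) (A B : set E) :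
  entropic g -> A `<=` B -> g A <= g B.
Proof.
move=> /entropicP[W [p [K [hp eK gE]]]] AB; rewrite !gE.
by apply: le_ker_entropy (ker_ofS AB) => //; have [] := eqv_ker_of B eK.
Qed.

Lemma entropic_submod (E : Type) (g : set E -> R) (A B : set E) :
  entropic g -> g (A `|` B) + g (A `&` B) <= g A + g B.
Proof.
move=> /entropicP[W [p [K [hp eK gE]]]]; rewrite !gE.
rewrite (eq_ker_entropy (s := fun w u => ker_of K A w u && ker_of K B w u)).
  by apply: ker_entropy_submod => //; do ?exact: eqv_ker_of;
    apply: ker_ofS => x [].
by move=> w u _ _; exact: ker_ofU.
Qed.

Lemma entropic_set0 (E : Type) (g : set E -> R) : entropic g -> g set0 = 0.
Proof.
move=> /entropicP[W [p [K [[p0 p1] eK ->]]]].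
rewrite /ker_entropy big1 ?oppr0// => w _.
rewrite (_ : mass _ _ _ = 1) ?ln1 ?mulr0//.
by rewrite -p1; apply: eq_bigl => u; apply/asboolP => i [].
Qed.

Lemma entropic_pullback (E E' : Type) (h : E' -> E) (g : set E -> R) :
  entropic g -> entropic (fun A => g (h @` A)).
Proof.
move=> /entropicP[W [p [K [hp eK gE]]]]; apply/entropicP.
exists W, p, (fun i => K (h i)); split => // A; rewrite gE.
by apply: eq_ker_entropy => w u _ _; exact: ker_of_image.
Qed.

(** Variables with index outside [T] are replaced by constants. *)
Lemma entropic_restr (E : Type) (T : set E) (g : set E -> R) :
  entropic g -> entropic (fun A => g (A `&` T)).
Proof.
move=> /entropicP[W [p [K [hp eK gE]]]]; apply/entropicP.
exists W, p, (fun i w u => (i \notin T) || K i w u); split => // [i|A].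
  case: (i \notin T) => //=.
rewrite gE; apply: eq_ker_entropy => w u _ _.
apply/asboolP/asboolP => h i.
  by move=> Ai; case: (boolP (i \in T)) => //= iT; apply: h; split=> //; exact: set_mem.
by move=> [Ai Ti]; have := h i Ai; rewrite mem_set.
Qed.

Lemma entropic0 (E : Type) : entropic (fun _ : set E => 0 : R).
Proof.
apply/entropicP; exists unit, (fun _ => 1), (fun _ _ _ => true); split => //.
- by split => //; rewrite big_const card_unit iter_addr addr0.
- move=> A; rewrite /ker_entropy big1 ?oppr0// => -[] _.
  rewrite (_ : mass _ _ _ = 1) ?ln1 ?mulr0// /mass (big_pred1 tt)// => -[].
  by apply/asboolP.
Qed.

End Shannon.

(** * Conditionally independent copies *)

Section Constructions.
Context {R : realType}.
Implicit Types Omega : finType.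

Lemma expect_push (W U : finType) (q : W -> R) (p : U -> R) (h : W -> U)
    (F : U -> R) :
  (forall u, \sum_(x | h x == u) q x = p u) ->
  \sum_x q x * F (h x) = \sum_u p u * F u.
Proof.
move=> qp; rewrite (partition_big h predT) //=; apply: eq_bigr => u _.
by rewrite -qp mulr_suml; apply: eq_bigr => x /eqP ->.
Qed.

Lemma ker_entropy_push (W U : finType) (q : W -> R) (p : U -> R) (h : W -> U)
    (r : rel U) :
  (forall u, \sum_(x | h x == u) q x = p u) ->
  ker_entropy q (fun x y => r (h x) (h y)) = ker_entropy p r.
Proof.
move=> qp; rewrite /ker_entropy; congr (- _).
rewrite -(expect_push (fun u => ln (mass p r u)) qp).
apply: eq_bigr => x _; congr (_ * ln _); rewrite /mass.
rewrite (partition_big h (r (h x))) //=; apply: eq_bigr => u ru.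
rewrite -qp; apply: eq_bigl => y; rewrite andbC.
by case: eqP => //= ->; rewrite ru.
Qed.

(* The joint law of two copies of a [p]-distributed point that are conditionally
   independent given its [r]-class. *)
Definition copy_pmf Omega (p : Omega -> R) (r : rel Omega) (x : Omega * Omega) : R :=
  if r x.1 x.2 then p x.1 * p x.2 / mass p r x.1 else 0.

Section Copy.
Variables (Omega : finType) (p : Omega -> R) (r : rel Omega).
Hypotheses (hp : is_pmf p) (er : eqv r).

Lemma copy_pmf_row u : \sum_v copy_pmf p r (u, v) = p u.
Proof.
rewrite /copy_pmf /= -big_mkcond /= -mulr_suml -mulr_sumr -/(mass p r u).
have [->|pu] := eqVneq (p u) 0; first by rewrite !mul0r.
by rewrite mulfK// gt_eqF// mass_gt0//; have [] := er.
Qed.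

Lemma copy_pmf_sym u v : copy_pmf p r (u, v) = copy_pmf p r (v, u).
Proof.
rewrite /copy_pmf /=; have [_ rS _] := er; rewrite (rS v u).
by case: ifP => // uv; rewrite (mass_eqv _ er uv) [p u * _]mulrC.
Qed.

Lemma copy_pmf_fst u : \sum_(x | x.1 == u) copy_pmf p r x = p u.
Proof.
transitivity (\sum_(a | a == u) \sum_v copy_pmf p r (a, v)).
  by rewrite pair_big /=; apply: eq_big => -[a b] //=; rewrite andbT.
by rewrite big_pred1_eq copy_pmf_row.
Qed.

Lemma copy_pmf_snd v : \sum_(x | x.2 == v) copy_pmf p r x = p v.
Proof.
rewrite -copy_pmf_fst (reindex_inj (h := fun x => (x.2, x.1))) /=; last first.
  by move=> [a b] [c d] [-> ->].
by apply: eq_bigr => -[a b] _; exact: copy_pmf_sym.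
Qed.

Lemma is_pmf_copy : is_pmf (copy_pmf p r).
Proof.
have [p0 p1] := hp; split.
  move=> [u v]; rewrite /copy_pmf /=; case: ifP => // _.
  by rewrite divr_ge0 ?mulr_ge0// mass_ge0.
rewrite -p1 (partition_big fst predT) //=.
by apply: eq_bigr => u _; exact: copy_pmf_fst.
Qed.

Lemma copy_pmf_supp x : copy_pmf p r x != 0 -> r x.1 x.2.
Proof. by rewrite /copy_pmf; case: ifP => //; rewrite eqxx. Qed.

(** As [s] refines [r], the class of a support point [(u, v)] has mass
    [mass p s u * mass p s v / mass p r u]. Take logarithms and use that both marginals are [p]. *)
Lemma ker_entropy_copy (s : rel Omega) : eqv s -> subrel s r ->
  ker_entropy (copy_pmf p r) (fun x y => s x.1 y.1 && s x.2 y.2) =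
  2 * ker_entropy p s - ker_entropy p r.
Proof.
move=> es sr; have [sR sS sT] := es; have [rR rS rT] := er.
pose L (t : rel Omega) u := ln (mass p t u).
rewrite /ker_entropy opprK mulrN mulrDl mul1r opprD.
rewrite -{1}(expect_push (L s) copy_pmf_fst) -(expect_push (L s) copy_pmf_snd).
rewrite -(expect_push (L r) copy_pmf_fst) -!sumrN -!big_split /=.
apply: eq_bigr => -[u v] _ /=.
have [->|q0] := eqVneq (copy_pmf p r (u, v)) 0.
  by rewrite !mul0r; ring.
have uv := copy_pmf_supp q0; rewrite /= in uv.
have pu : p u != 0.
  by apply: contraNneq q0 => pu; rewrite /copy_pmf /= pu !mul0r if_same.
have pv : p v != 0.
  by apply: contraNneq q0 => pv; rewrite /copy_pmf /= pv mulr0 mul0r if_same.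
rewrite (_ : mass _ _ _ = mass p s u * mass p s v / mass p r u); last first.
  rewrite /mass -(pair_big (s u) (s v) (fun a b => copy_pmf p r (a, b))) /=.
  rewrite !mulr_suml; apply: eq_bigr => a ua.
  rewrite mulr_sumr mulr_suml; apply: eq_bigr => b vb.
  have ra := sr _ _ ua; have rb := sr _ _ vb.
  rewrite /copy_pmf /= ifT; last by rewrite -(eqv_trans_eq _ er ra); exact: rT uv rb.
  by rewrite -/(mass p r u) (mass_eqv p er ra).
have := (mass_gt0 hp sR pu, mass_gt0 hp sR pv, mass_gt0 hp rR pu).
move=> [[m1 m2] m3]; rewrite ln_div ?posrE ?mulr_gt0// lnM ?posrE//.
rewrite /L; ring.
Qed.

End Copy.

(** The elements of [X] are shared literally, so no quotient is formed; the points [inr x] with [x]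
    in [X] lie in neither copy. *)
Definition second_copy (E : Type) (X : set E) (x : E) : E + E :=
  if x \in X then inl x else inr x.

Lemma entropic_copy (E : Type) (X : set E) (g : set E -> R) : entropic g ->
  exists g' : set (E + E) -> R,
  [/\ entropic g',
      forall A, g' (inl @` A) = g A,
      forall A, g' (second_copy X @` A) = g A,
      g' setT = 2 * g setT - g X &
      g' (range inl `|` range (second_copy X)) = g' setT].
Proof.
move=> /entropicP[W [p [K [hp eK gE]]]].
pose rX := ker_of K X; have eX : eqv rX by exact: eqv_ker_of.
pose q := copy_pmf p rX.
pose K' (i : E + E) (x y : W * W) :=
  match i with inl i => K i x.1 y.1 | inr i => K i x.2 y.2 end.
have hq : is_pmf q by exact: is_pmf_copy.
have eK' i : eqv (K' i).
  by case: i => i; [exact: (eqv_comp (@fst W W) (eK i))|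
                    exact: (eqv_comp (@snd W W) (eK i))].
pose g' A := ker_entropy q (ker_of K' A).
have g'ent : entropic g' by apply/entropicP; exists (W * W)%type, q, K'; split.
have g'1 A : g' (inl @` A) = g A.
  rewrite gE -(ker_entropy_push _ (copy_pmf_fst hp eX)).
  by apply: eq_ker_entropy => x y _ _; rewrite ker_of_image.
(* On the support the two coordinates are equivalent for every [K i] with [i] in [X], so such a
   variable can be read from either coordinate. *)
have second_ker A x y : q x != 0 -> q y != 0 ->
    ker_of K' (second_copy X @` A) x y = ker_of K A x.2 y.2.
  move=> /copy_pmf_supp/asboolP hx /copy_pmf_supp/asboolP hy.
  have hxy i : X i -> K i x.1 y.1 = K i x.2 y.2.
    move=> Xi; have [_ kS _] := eK i.
    rewrite (eqv_trans_eq _ (eK i) (hx _ Xi)) kS.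
    by rewrite (eqv_trans_eq _ (eK i) (hy _ Xi)) kS.
  rewrite ker_of_image; apply/asboolP/asboolP => h i Ai; have {h} := h i Ai;
    by rewrite /second_copy; case: ifPn => //= /set_mem Xi; rewrite hxy.
(* Restricting to the two copies silences the stray points, so the total value is the value at
   [D]. *)
pose D : set (E + E) := range inl `|` range (second_copy X).
exists (fun A => g' (A `&` D)); split.
- exact: entropic_restr.
- by move=> A; rewrite setIidl// => _ [x _ <-]; left; exists x.
- move=> A; rewrite setIidl; last by move=> _ [x _ <-]; right; exists x.
  rewrite gE -(ker_entropy_push _ (copy_pmf_snd hp eX)).
  exact: eq_ker_entropy (second_ker A).
- rewrite setTI !gE -/rX -(ker_entropy_copy hp eX (eqv_ker_of setT eK)); last first.
    exact: ker_ofS.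
  apply: eq_ker_entropy => x y qx qy.
  by rewrite ker_ofU second_ker// ker_of_image.
- by rewrite setIid setTI.
Qed.

(** Realize [f] and [g] independently on the product space and pair the variables: masses of classes
    multiply, so their logarithms add. *)
Lemma entropicD (E : Type) (f g : set E -> R) :
  entropic f -> entropic g -> entropic (fun A => f A + g A).
Proof.
move=> /entropicP[W [p [K [hp eK fE]]]] /entropicP[U [q [L [hq eL gE]]]].
have [[p0 p1] [q0 q1]] := (hp, hq).
pose pq (x : W * U) := p x.1 * q x.2.
have pq_fst w : \sum_(x | x.1 == w) pq x = p w.
  transitivity (\sum_(a | a == w) \sum_b p a * q b).
    by rewrite pair_big /=; apply: eq_big => // x; rewrite andbT.
  by rewrite big_pred1_eq -mulr_sumr q1 mulr1.
have pq_snd u : \sum_(x | x.2 == u) pq x = q u.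
  transitivity (\sum_a \sum_(b | b == u) p a * q b).
    by rewrite pair_big /=; apply: eq_big.
  by under eq_bigr do rewrite big_pred1_eq; rewrite -mulr_suml p1 mul1r.
apply/entropicP; exists (W * U)%type, pq, (fun i x y => K i x.1 y.1 && L i x.2 y.2).
split.
- split => [x|]; first exact: mulr_ge0.
  by rewrite -p1 (partition_big fst predT) //=; apply: eq_bigr => u _; exact: pq_fst.
- move=> i; apply: eqv_andb; first exact: (eqv_comp (@fst W U) (eK i)).
  exact: (eqv_comp (@snd W U) (eL i)).
move=> A; rewrite fE gE.
rewrite (eq_ker_entropy (r := ker_of _ _)
  (s := fun x y => ker_of K A x.1 y.1 && ker_of L A x.2 y.2)); last first.
  move=> x y _ _; apply/asboolP/andP => [h|[/asboolP h1 /asboolP h2] i Ai].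
    by split; apply/asboolP => i /h /andP[].
  by rewrite h1// h2.
rewrite -(ker_entropy_push _ pq_fst) -(ker_entropy_push _ pq_snd) -opprD -big_split /=.
congr (- _); apply: eq_bigr => -[w u] _ /=.
have [->|pqn0] := eqVneq (pq (w, u)) 0; first by rewrite !mul0r addr0.
have /andP[pw qu] : (p w != 0) && (q u != 0) by rewrite -negb_or -mulf_eq0.
have mass1 : mass pq (fun x y => ker_of K A x.1 y.1) (w, u) = mass p (ker_of K A) w.
  rewrite /mass (partition_big fst (ker_of K A w)) //=; apply: eq_bigr => a wa.
  by rewrite -pq_fst; apply: eq_bigl => x; rewrite andbC; case: eqP => //= ->.
have mass2 : mass pq (fun x y => ker_of L A x.2 y.2) (w, u) = mass q (ker_of L A) u.
  rewrite /mass (partition_big snd (ker_of L A u)) //=; apply: eq_bigr => a wa.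
  by rewrite -pq_snd; apply: eq_bigl => x; rewrite andbC; case: eqP => //= ->.
rewrite -mulrDr mass1 mass2 -lnM ?posrE; last 2 first.
- by apply: mass_gt0 => //; have [] := eqv_ker_of A eK.
- by apply: mass_gt0 => //; have [] := eqv_ker_of A eL.
congr (_ * ln _); rewrite /mass mulr_suml /=.
rewrite -(pair_big (ker_of K A w) (ker_of L A u) (fun a b => pq (a, b))) /=.
by apply: eq_bigr => a _; rewrite mulr_sumr.
Qed.

Lemma entropicMn (E : Type) (f : set E -> R) n :
  entropic f -> entropic (fun A => n%:R * f A).
Proof.
move=> fent; elim: n => [|n IHn].
  by rewrite (_ : (fun _ => _) = fun=> 0); [exact: entropic0|
    apply/funext => A; rewrite mul0r].
rewrite (_ : (fun _ => _) = fun A => f A + n%:R * f A); first exact: entropicD.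
by apply/funext => A; rewrite -natr1; ring.
Qed.

End Constructions.

(** * The convex cone of limits of entropic functions *)

Section Cone.
Context {R : realType}.

Lemma big_unit (F : unit -> R) (P : pred unit) :
  \sum_(i | P i) F i = if P tt then F tt else 0.
Proof.
case: ifP => Pt; first by rewrite (big_pred1 tt) // => -[].
by rewrite big_pred0 // => -[].
Qed.

Lemma binary_entropy_ge0 (t : R) : 0 < t -> t < 1 ->
  0 <= - ((1 - t) * ln (1 - t) + t * ln t).
Proof.
move=> t0 t1; rewrite oppr_ge0.
have l1 : ln (1 - t) <= 0 by apply: ln_le0; lra.
have l2 : ln t <= 0 by apply: ln_le0; lra.
have : (1 - t) * ln (1 - t) <= 0 by apply: mulr_ge0_le0; lra.
have : t * ln t <= 0 by apply: mulr_ge0_le0; lra.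
lra.
Qed.

(** Two uses of [ln x <= x - 1], at the inverses of [1 - t] and of the square root of [t], bound the
    two summands by [t <= s] and by twice that root, hence by [2 * s]. *)
Lemma binary_entropy_le (t s : R) : 0 < t -> t < 1 -> 0 < s -> s <= 1 ->
  t <= s ^+ 2 -> - ((1 - t) * ln (1 - t) + t * ln t) <= 3 * s.
Proof.
move=> t0 t1 s0 s1 ts.
have h1 : - ((1 - t) * ln (1 - t)) <= t.
  have u0 : 0 < 1 - t by lra.
  have := @ln_le_subr1 R (1 - t)^-1; rewrite invr_gt0 => /(_ u0).
  rewrite lnV ?posrE// => h.
  have := ler_wpM2l (ltW u0) h; rewrite mulrBr mulfV ?gt_eqF//; lra.
pose q := Num.sqrt t.
have q0 : 0 < q by rewrite sqrtr_gt0.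
have qs : q <= s.
  by rewrite -(@ler_pXn2r _ 2) ?nnegrE ?(ltW q0) ?(ltW s0)// sqr_sqrtr ?(ltW t0).
have tq : t = q ^+ 2 by rewrite sqr_sqrtr// ltW.
have h2 : - (t * ln t) <= 2 * q.
  have := @ln_le_subr1 R q^-1; rewrite invr_gt0 => /(_ q0).
  rewrite lnV ?posrE// => h.
  have q20 : 0 <= 2 * q ^+ 2 by rewrite mulr_ge0// sqr_ge0.
  have := ler_wpM2l q20 h.
  have -> : 2 * q ^+ 2 * (q^-1 - 1) = 2 * q - 2 * q ^+ 2 by field; rewrite gt_eqF.
  rewrite tq lnXn// mulr2n; nra.
nra.
Qed.

(** Run the variables with probability [t] and otherwise move to an extra point where each takes a
    fresh value. For nonempty [A] the result is [t * f A] plus the binary entropy of [t], an error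
    independent of [A]. *)
Lemma entropic_scale (E : Type) (f : set E -> R) (t s : R) :
  entropic f -> 0 < t -> t < 1 -> 0 < s -> s <= 1 -> t <= s ^+ 2 ->
  exists2 g, entropic g & forall A, `|g A - t * f A| <= 3 * s.
Proof.
move=> fent t0 t1 s0 s1 ts.
have f0 := entropic_set0 fent.
have /entropicP[W [p [K [hp eK fE]]]] := fent; have [p0 p1] := hp.
pose q (x : unit + W) := match x with inl _ => 1 - t | inr w => t * p w end.
pose K' i (x y : unit + W) := match x, y with
  | inl _, inl _ => true | inr w, inr u => K i w u | _, _ => false end.
have eK' i : eqv (K' i).
  have [kR kS kT] := eK i.
  by split => [[]|[x|x] [y|y]|[y|y] [x|x] [z|z]] //=; exact: kT.
have hq : is_pmf q.
  split; first by move=> [x|w] /=; [lra|apply: mulr_ge0 => //; lra].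
  by rewrite big_sumType /= big_unit -mulr_sumr p1; lra.
pose g A := ker_entropy q (ker_of K' A).
have gent : entropic g by apply/entropicP; exists (unit + W)%type, q, K'.
exists g => // A.
have [->|/set0P[i Ai]] := eqVneq A set0.
  by rewrite f0 (entropic_set0 gent) mulr0 subrr normr0; lra.
have -> : g A = t * f A - ((1 - t) * ln (1 - t) + t * ln t).
  have kll x y : ker_of K' A (inl x) (inl y) by apply/asboolP.
  have klr x y : ker_of K' A (inl x) (inr y) = false by apply/asboolP => /(_ i Ai).
  have krl x y : ker_of K' A (inr x) (inl y) = false by apply/asboolP => /(_ i Ai).
  have krr x y : ker_of K' A (inr x) (inr y) = ker_of K A x y by [].
  rewrite /g fE /ker_entropy big_sumType /= big_unit /=.
  have -> : mass q (ker_of K' A) (inl tt) = 1 - t.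
    rewrite /mass big_sumType /= big_unit kll big1 ?addr0// => w.
    by rewrite klr.
  under eq_bigr => w _.
    have -> : t * p w * ln (mass q (ker_of K' A) (inr w)) =
        t * ln t * p w + t * (p w * ln (mass p (ker_of K A) w)).
      have [->|pw] := eqVneq (p w) 0; first by rewrite !(mul0r, mulr0) addr0.
      have -> : mass q (ker_of K' A) (inr w) = t * mass p (ker_of K A) w.
        rewrite /mass big_sumType /= big_unit krl add0r mulr_sumr.
        by apply: eq_bigl => u; rewrite krr.
      rewrite lnM ?posrE//; first ring.
      by apply: mass_gt0 => //; have [] := eqv_ker_of A eK.
    over.
  by rewrite big_split /= -!mulr_sumr p1; ring.
rewrite addrAC subrr add0r ger0_norm; first exact: binary_entropy_le.
exact: binary_entropy_ge0.
Qed.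

Definition unif_entropic (E : Type) (f : set E -> R) : Prop :=
  forall eps, 0 < eps -> exists2 g, entropic g & forall A, `|g A - f A| <= eps.

Lemma entropic_unif (E : Type) (f : set E -> R) : entropic f -> unif_entropic f.
Proof. by move=> fe e e0; exists f => // A; rewrite subrr normr0 ltW. Qed.

Lemma unif_entropicD (E : Type) (f g : set E -> R) :
  unif_entropic f -> unif_entropic g -> unif_entropic (fun A => f A + g A).
Proof.
move=> hf hg e e0; have e2 : 0 < e / 2 by lra.
have [f' ? ff'] := hf _ e2; have [g' ? gg'] := hg _ e2.
exists (fun A => f' A + g' A); first exact: entropicD.
move=> A; have := ff' A; have := gg' A; rewrite !ler_norml => /andP[? ?] /andP[? ?].
by apply/andP; lra.
Qed.

(** Integer multiples are entropic, so [c * f] is [N * f] scaled by the small factor [c / N], and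
    the error of such a scaling vanishes with the factor. *)
Lemma unif_entropicZ (E : Type) (c : R) (f : set E -> R) :
  0 <= c -> entropic f -> unif_entropic (fun A => c * f A).
Proof.
rewrite le_eqVlt => /predU1P[<- fe e e0|c0 fe e e0].
  by exists (fun=> 0); [exact: entropic0|move=> A; rewrite mul0r subrr normr0 ltW].
(* The bound [e / 3] absorbs the constant of [entropic_scale]; the bound [2^-1] ensures
   [c / N < 1]. *)
pose s := Num.min (2^-1) (e / 3).
have s0 : 0 < s by rewrite lt_min; apply/andP; lra.
have s1 : s <= 2^-1 by rewrite ge_min lexx.
have se : s <= e / 3 by rewrite ge_min lexx orbT.
have ss0 : 0 < s ^+ 2 by rewrite exprn_gt0.
pose N := (Num.truncn (c / s ^+ 2)).+1.
have N0 : 0 < N%:R :> R by rewrite ltr0n.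
have hN : c < N%:R * s ^+ 2 by rewrite -ltr_pdivrMr//; exact: truncnS_gt.
have t0 : 0 < c / N%:R by rewrite divr_gt0.
have ts : c / N%:R <= s ^+ 2 by rewrite ler_pdivrMr// mulrC ltW.
have t1 : c / N%:R < 1 by apply: le_lt_trans ts _; nra.
have s1' : s <= 1 by lra.
have [g ge gA] := entropic_scale (entropicMn N fe) t0 t1 s0 s1' ts.
exists g => // A; have := gA A; rewrite mulrA divfK ?gt_eqF// => /le_trans; apply.
lra.
Qed.

Lemma unif_entropic_sum (E : Type) (I : finType) (f : I -> set E -> R) :
  (forall i, unif_entropic (f i)) -> unif_entropic (fun A => \sum_i f i A).
Proof.
move=> hf; elim: (index_enum I) => [|i r IHr].
  under [X in unif_entropic X]eq_fun => A do rewrite big_nil.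
  exact/entropic_unif/entropic0.
under [X in unif_entropic X]eq_fun => A do rewrite big_cons.
exact: unif_entropicD.
Qed.

Lemma unif_entropic_contract (E : Type) (Z : set E) (f : set E -> R) :
  entropic f -> unif_entropic (fun A => f (A `|` Z) - f Z).
Proof.
move=> /entropicP[W [p [K [hp eK fE]]]]; have [p0 p1] := hp.
pose r := ker_of K Z; have er : eqv r by exact: eqv_ker_of.
have [rR rS rT] := er.
pose c := mass p r.
(* The conditional law given the class of [w], with junk value [p] if [p w = 0]. *)
pose pc w u := if p w == 0 then p u else copy_pmf p r (w, u) / p w.
have hpc w : is_pmf (pc w).
  have hc := is_pmf_copy hp er.
  split => [u|]; rewrite /pc; case: eqVneq => // pw.
    by rewrite divr_ge0//; have [] := hc.
  by rewrite -mulr_suml copy_pmf_row// divff.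
rewrite (_ : (fun _ => _) = fun A => \sum_w p w * ker_entropy (pc w) (ker_of K A)).
  apply: unif_entropic_sum => w; apply: unif_entropicZ => //.
  by apply/entropicP; exists W, (pc w), K.
apply/funext => A.
pose s u v := ker_of K A u v && r u v.
have es : eqv s by apply: eqv_andb => //; exact: eqv_ker_of.
transitivity (ker_entropy p s - ker_entropy p r).
  rewrite !fE; congr (_ - _); apply: eq_ker_entropy => w u _ _.
  exact: ker_ofU.
rewrite /ker_entropy.
pose F u := ln (mass p s u) - ln (mass p r u).
transitivity (- \sum_u p u * F u).
  by rewrite opprK -sumrN -big_split -sumrN; apply: eq_bigr => w _; rewrite /F /=; ring.
(* [copy_pmf] draws [w] from [p] and then [u] from the class of [w]. Its second marginal is [p], so
   an expectation over [u] becomes a mean over [w] of expectations under [pc w]. *)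
rewrite -(expect_push F (copy_pmf_snd hp er)) -sumrN.
rewrite -(pair_big predT predT (fun w u => - (copy_pmf p r (w, u) * F u))) /=.
apply: eq_bigr => w _; rewrite sumrN mulrN; congr (- _).
rewrite mulr_sumr; apply: eq_bigr => u _.
have [pw|pw] := eqVneq (p w) 0.
  by rewrite pw mul0r /copy_pmf /= pw !mul0r if_same mul0r.
have [q0|q0] := eqVneq (copy_pmf p r (w, u)) 0.
  by rewrite q0 /pc (negbTE pw) q0 !mul0r mulr0.
have wu := copy_pmf_supp q0; rewrite /= in wu.
have pu : p u != 0.
  by apply: contraNneq q0 => pu; rewrite /copy_pmf /= pu mulr0 mul0r if_same.
rewrite mulrA; congr (_ * _).
  by rewrite /pc (negbTE pw) mulrC divfK.
have -> : mass (pc w) (ker_of K A) u = mass p s u / mass p r u.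
  rewrite /mass [LHS]big_mkcond mulr_suml [RHS]big_mkcond /=.
  apply: eq_bigr => v _; rewrite /s; case: (ker_of K A u v) => //=.
  rewrite /pc (negbTE pw) /copy_pmf /= (eqv_trans_eq v er wu).
  case: ifP => _; last by rewrite mul0r.
  rewrite -/(mass p r u) (mass_eqv p er wu).
  have := mass_gt0 hp rR pu => /lt0r_neq0 m0.
  by field; rewrite ?pw ?m0.
by rewrite ln_div ?posrE// mass_gt0//; have [] := es.
Qed.

End Cone.

(** * Closure of the entropic functions *)

Section Limits.
Context {R : realType}.

(* Membership in the closure of the entropic functions for the topology of
   pointwise convergence. *)
Definition closure_entropic (E : Type) (h : set E -> R) : Prop :=
  forall (J : finType) (L : J -> set E) eps, 0 < eps ->
  exists2 g, entropic g & forall j, `|h (L j) - g (L j)| < eps.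

(** The entropic functions themselves serve as index type, with the trace of the neighbourhood
    filter of [h]; this trace is proper because [h] lies in the closure. *)
Lemma closure_entropicP (E : Type) (h : set E -> R) :
  closure_entropic h <->
  exists (I : Type) (F : set_system I) (g : I -> set E -> R),
    [/\ ProperFilter F, forall i, entropic (g i) &
        forall A : set E, g i A @[i --> F] --> h A].
Proof.
split=> [hh|[I [F [g [FF ge gh]]]] J L e e0]; last first.
  have FL : F [set i | forall j, `|h (L j) - g i (L j)| < e].
    apply: filter_forall => j.
    have /cvgrPdist_lt/(_ e e0) := gh (L j); exact.
  by have [i hi] := filter_ex FL; exists (g i).
pose I := sig (@entropic R E).
pose F : set_system I := [set P | exists (J : finType) (L : J -> set E) e,
  0 < e /\ forall g : I, (forall j, `|h (L j) - sval g (L j)| < e) -> P g].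
have PF : ProperFilter F.
  split.
    move=> [J [L [e [e0 h0]]]]; have [g ge gL] := hh J L e e0.
    exact: (h0 (exist _ g ge)).
  split.
  - by exists unit, (fun=> set0), 1.
  - move=> P Q [J [L [e [e0 hP]]]] [J' [L' [e' [e'0 hQ]]]].
    exists (J + J')%type, (fun x => match x with inl j => L j | inr j => L' j end).
    exists (Num.min e e'); split; first by rewrite lt_min e0.
    move=> g hg; split.
      by apply: hP => j; have := hg (inl j); rewrite lt_min => /andP[].
    by apply: hQ => j; have := hg (inr j); rewrite lt_min => /andP[].
  - move=> P Q PQ [J [L [e [e0 hP]]]]; exists J, L, e; split => // g /hP.
    exact: PQ.
exists I, F, sval; split => // [[]//|A].
apply/cvgrPdist_lt => e e0; exists unit, (fun=> A), e; split => // g.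
exact.
Qed.

(** Compactness of the interval gives a cluster point, and a cluster point of an ultrafilter is a
    limit. *)
Lemma ultra_cvg (I : Type) (U : set_system I) (f : I -> R) (a b : R) :
  UltraFilter U -> U [set i | a <= f i <= b] ->
  exists l : R, f i @[i --> U] --> l.
Proof.
move=> UU Uab; have PU : ProperFilter U by exact: ultra_proper.
have Fab : (f i @[i --> U]) `[a, b]%classic.
  by rewrite /fmap/=; apply: filterS Uab => i /=; rewrite in_itv.
have [l [_ cl]] := segment_compact (fmap_proper_filter f PU) Fab.
exists l => N Nl; rewrite /fmap /=.
have [//|UC] := in_ultra_setVsetC (f @^-1` N) UU.
by have [x []] := cl (~` N) N UC Nl.
Qed.

Record rank_fun (E : Type) (h : set E -> R) : Prop := RankFun {
  rank_set0 : h set0 = 0;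
  rank_mono : forall A B, A `<=` B -> h A <= h B;
  rank_submod : forall A B, h (A `|` B) + h (A `&` B) <= h A + h B
}.

Lemma closure_entropic_rank (E : Type) (h : set E -> R) :
  closure_entropic h -> rank_fun h.
Proof.
move=> hh; split.
- apply/eqP; rewrite -normr_eq0; apply/eqP/le_anti; rewrite normr_ge0 andbT.
  apply/ler_addgt0Pr => e e0; rewrite add0r.
  have [g ge /(_ tt)] := hh unit (fun=> set0) e e0.
  by rewrite (entropic_set0 ge) subr0 => /ltW.
- move=> A B AB; apply/ler_addgt0Pr => e e0; have e2 : 0 < e / 2 by lra.
  have [g ge gL] := hh bool (fun b => if b then A else B) _ e2.
  have := gL true; have := gL false; have := entropic_mono ge AB.
  rewrite /= !ltr_norml => ? /andP[? ?] /andP[? ?]; lra.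
- move=> A B; apply/ler_addgt0Pr => e e0; have e2 : 0 < e / 4 by lra.
  pose L (x : bool * bool) := match x with (true, true) => A | (true, false) => B
    | (false, true) => A `|` B | (false, false) => A `&` B end.
  have [g ge gL] := hh _ L _ e2.
  have := (gL (true, true), gL (true, false), gL (false, true), gL (false, false)).
  have := entropic_submod A B ge.
  by rewrite /= !ltr_norml => ? [[[/andP[? ?] /andP[? ?]] /andP[? ?]] /andP[? ?]]; lra.
Qed.

Lemma closure_entropic_copy (E : Type) (X : set E) (h : set E -> R) :
  closure_entropic h ->
  exists h' : set (E + E) -> R,
  [/\ closure_entropic h',
      forall A, h' (inl @` A) = h A,
      forall A, h' (second_copy X @` A) = h A,
      h' setT = 2 * h setT - h X &
      h' (range inl `|` range (second_copy X)) = h' setT].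
Proof.
move=> /closure_entropicP[I [F [g [FF ge gh]]]].
have [U [UU FU]] := ultraFilterLemma FF.
have PU : ProperFilter U by exact: ultra_proper.
have {}gh A : g i A @[i --> U] --> h A by move=> N /gh; exact: FU.
have [g' g'P] := choice (fun i => entropic_copy X (ge i)).
have g'e i : entropic (g' i) by have [] := g'P i.
have ex A : exists l : R, g' i A @[i --> U] --> l.
  (* Eventually [g i setT <= h setT + 1], and [g' i A] is at most the total
     [2 * g i setT - g i X]. *)
  apply: (@ultra_cvg _ _ _ 0 (2 * (h setT + 1))).
  have /cvgrPdist_lt/(_ 1 ltr01) := gh setT.
  apply: filterS => i /=; rewrite ltr_norml => /andP[? ?]; apply/andP; split.
    by rewrite -(entropic_set0 (g'e i)); exact: entropic_mono.
  apply: (le_trans (entropic_mono (g'e i) (@subsetT _ A))).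
  have := entropic_mono (ge i) (sub0set X); rewrite (entropic_set0 (ge i)).
  by have [_ _ _ -> _] := g'P i; lra.
have [h' h'P] := choice ex; exists h'; split.
- by apply/closure_entropicP; exists I, U, g'; split.
- move=> A; have := h'P (inl @` A).
  rewrite (_ : (fun i => g' i _) = fun i => g i A).
    by move=> lim'; exact: cvg_unique lim' (gh A).
  by apply/funext => i; have [] := g'P i.
- move=> A; have := h'P (second_copy X @` A).
  rewrite (_ : (fun i => g' i _) = fun i => g i A).
    by move=> lim'; exact: cvg_unique lim' (gh A).
  by apply/funext => i; have [] := g'P i.
- have := h'P setT.
  rewrite (_ : (fun i => g' i _) = fun i => 2 * g i setT - g i X).
    move=> lim'; apply: cvg_unique lim' _ => //.
    by apply: cvgB; [apply: cvgMr|].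
  by apply/funext => i; have [] := g'P i.
- have := h'P (range inl `|` range (second_copy X)).
  rewrite (_ : (fun i => g' i _) = fun i => g' i setT).
    by move=> lim'; exact: cvg_unique lim' (h'P setT).
  by apply/funext => i; have [] := g'P i.
Qed.

Lemma closure_entropic_pullback (E E' : Type) (k : E' -> E) (h : set E -> R) :
  closure_entropic h -> closure_entropic (fun A => h (k @` A)).
Proof.
move=> hh J L e e0; have [g ge gL] := hh J (fun j => k @` L j) e e0.
by exists (fun A => g (k @` A)) => //; exact: entropic_pullback.
Qed.

Definition rank_contract (E : Type) (h : set E -> R) (Z A : set E) : R :=
  h (A `|` Z) - h Z.

Lemma closure_entropic_contract (E : Type) (Z : set E) (h : set E -> R) :
  closure_entropic h -> closure_entropic (rank_contract h Z).
Proof.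
move=> hh J L e e0; have e4 : 0 < e / 4 by lra.
have [g ge gL] := hh (option J) (oapp (fun j => L j `|` Z) Z) _ e4.
have [g' g'e g'L] := unif_entropic_contract Z ge e4.
exists g' => // j; have := (gL None, gL (Some j), g'L (L j)).
rewrite /rank_contract /= !ltr_norml !ler_norml.
by move=> [[/andP[? ?] /andP[? ?]] /andP[? ?]]; apply/andP; lra.
Qed.

(** * Regularization to finite type *)

Definition finitary (E : Type) (h : set E -> R) (A : set E) : R :=
  sup (h @` [set F | finite_set F /\ F `<=` A]).

Section Finitary.
Variables (E : Type) (h : set E -> R).
Hypothesis hh : rank_fun h.

Let has_sup_fin (A : set E) : has_sup (h @` [set F | finite_set F /\ F `<=` A]).
Proof.
split; first by exists (h set0), set0 => //; split => //; exact: sub0set.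
by exists (h A) => _ [F [_ FA] <-]; exact: rank_mono.
Qed.

Lemma finitary_ge (A F : set E) : finite_set F -> F `<=` A -> h F <= finitary h A.
Proof.
by move=> fF FA; apply: ub_le_sup; [have [] := has_sup_fin A|exists F].
Qed.

Lemma finitary_le (A : set E) c :
  (forall F, finite_set F -> F `<=` A -> h F <= c) -> finitary h A <= c.
Proof.
move=> hc; apply: ge_sup; first by have [] := has_sup_fin A.
by move=> _ [F [fF FA] <-]; exact: hc.
Qed.

Lemma finitary_fin (A : set E) : finite_set A -> finitary h A = h A.
Proof.
move=> fA; apply/le_anti/andP; split; last exact: finitary_ge.
by apply: finitary_le => F _; exact: rank_mono.
Qed.

Lemma finitary_approx (A : set E) e : 0 < e ->
  exists F, [/\ finite_set F, F `<=` A & finitary h A - e < h F].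
Proof.
move=> e0; have [_ [F [fF FA] <-] eF] := sup_adherent e0 (has_sup_fin A).
by exists F.
Qed.

Lemma finite_type_finitary : finite_type (finitary h).
Proof.
move=> A; congr (sup _); apply/seteqP; split => _ [F [fF FA] <-]; exists F => //;
  by rewrite finitary_fin.
Qed.

Lemma polymatroid_finitary : polymatroid (finitary h).
Proof.
split; last exact: finite_type_finitary.
- by rewrite finitary_fin// rank_set0.
- move=> A B AB; apply: finitary_le => F fF FA; apply: finitary_ge => //.
  exact: subset_trans FA AB.
- move=> A B; apply/ler_addgt0Pr => e e0; have e2 : 0 < e / 2 by lra.
  have [F [fF FAB hF]] := finitary_approx (A `|` B) e2.
  have [G [fG GAB hG]] := finitary_approx (A `&` B) e2.
  (* Adjoining [G] to both parts of [F] keeps them inside [A] and [B] and puts [G] into their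
     intersection. *)
  have hA : h ((F `&` A) `|` G) <= finitary h A.
    apply: finitary_ge; first by rewrite finite_setU; split=> //; exact: finite_setIl.
    by move=> x [[]//|/GAB[]].
  have hB : h ((F `&` B) `|` G) <= finitary h B.
    apply: finitary_ge; first by rewrite finite_setU; split=> //; exact: finite_setIl.
    by move=> x [[]//|/GAB[]].
  have := rank_submod hh ((F `&` A) `|` G) ((F `&` B) `|` G).
  have h1 : h F <= h (((F `&` A) `|` G) `|` ((F `&` B) `|` G)).
    by apply: rank_mono => // x Fx; have [Ax|Bx] := FAB x Fx; [left|right]; left.
  have h2 : h G <= h (((F `&` A) `|` G) `&` ((F `&` B) `|` G)).
    by apply: rank_mono => // x Gx; split; right.
  lra.
Qed.

End Finitary.

(** Take finite [T j] nearly attaining the suprema, and their union [U]. The value of [h] at the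
    trace of [L j] on [U] lies between [h (T j)] and the supremum; it is approximated by an entropic
    function, which remains entropic when restricted to [U]. *)
Lemma almost_entropic_finitary (E : Type) (h : set E -> R) :
  closure_entropic h -> almost_entropic (finitary h).
Proof.
move=> hc; have hh := closure_entropic_rank hc.
split; first exact: finite_type_finitary.
apply/closure_entropicP => J L e e0; have e2 : 0 < e / 2 by lra.
have [T TP] := choice (fun j => finitary_approx hh (L j) e2).
pose U := \bigcup_j T j.
have fU : finite_set U.
  by apply: bigcup_finite => // j _; have [] := TP j.
have [g ge gL] := hc J (fun j => L j `&` U) _ e2.
exists (fun A => g (A `&` U)); first exact: entropic_restr.
move=> j; have [fT TL hT] := TP j; have := gL j.
have h1 : h (T j) <= h (L j `&` U).
  by apply: rank_mono => // x Tx; split; [exact: TL|exists j].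
have h2 : h (L j `&` U) <= finitary h (L j).
  by apply: finitary_ge => //; exact: finite_setIr.
rewrite !ltr_norml => /andP[? ?]; apply/andP; lra.
Qed.

Lemma finitary_finite_type (E : Type) (h : set E -> R) :
  finite_type h -> finitary h = h.
Proof. by move=> hf; apply/funext => A; rewrite [RHS]hf. Qed.

End Limits.

(** * Spanning *)

Section Spanning.
Context {R : realType}.

Definition spans (E : Type) (h : set E -> R) (A B : set E) : Prop :=
  h (A `|` B) = h A.

Section RankFun.
Variables (E : Type) (h : set E -> R).
Hypothesis hh : rank_fun h.
Implicit Types (A B C : set E) (x y z : E).

Lemma rank_ge0 A : 0 <= h A.
Proof. by rewrite -(rank_set0 hh); apply: rank_mono => //; exact: sub0set. Qed.

Lemma rankU A B : h (A `|` B) <= h A + h B.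
Proof. by have := rank_submod hh A B; have := rank_ge0 (A `&` B); lra. Qed.

Lemma spans_le A B : h (A `|` B) <= h A -> spans h A B.
Proof.
by move=> AB; apply/le_anti; rewrite AB /=; apply: rank_mono => // x; left.
Qed.

Lemma spansW A A' B : A `<=` A' -> spans h A B -> spans h A' B.
Proof.
move=> AA' AB; apply: spans_le; have := rank_submod hh (A `|` B) A'.
have : h A <= h ((A `|` B) `&` A').
  by apply: rank_mono => // x Ax; split; [left|exact: AA'].
have : h (A' `|` B) <= h ((A `|` B) `|` A').
  by apply: rank_mono => // x [Ax|Bx]; [right|left; right].
rewrite AB; lra.
Qed.

Lemma spans_sub A B : B `<=` A -> spans h A B.
Proof. by move=> BA; apply: spans_le; rewrite setUidl. Qed.

Lemma spans_trans A B C : spans h A B -> spans h B C -> spans h A C.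
Proof.
move=> AB /(spansW (@subsetUr _ A B)) BC; apply: spans_le.
rewrite -[leRHS]AB -[leRHS]BC; apply: rank_mono => // x.
by move=> [Ax|Cx]; [left; left|right].
Qed.

Lemma spansU A B C : spans h A B -> spans h A C -> spans h A (B `|` C).
Proof.
move=> AB /(spansW (@subsetUl _ A B)) BC.
by rewrite /spans setUA BC.
Qed.

Lemma spans_rank A B : spans h A B -> h B <= h A.
Proof. by move=> <-; apply: rank_mono => // x; right. Qed.

Lemma spans_add A B C : spans h A B -> spans h (A `|` B) C -> spans h A C.
Proof. by move=> AB; apply: spans_trans; exact: spansU (spans_sub _) AB. Qed.

End RankFun.

Lemma spans_fin (E : Type) (h : set E -> R) (A B : set E) : rank_fun h ->
  finite_set B -> (forall x, B x -> spans h A [set x]) -> spans h A B.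
Proof.
(* Listing a finite set as a sequence asks for a choice type, a structure that [E] receives
   classically. *)
elim/Pchoice: E h A B => T k A B kk /finite_seqP[s ->{B}].
elim: s => [|x s IHs] sp; first exact: spans_sub.
have /IHs IH : forall y, [set` s] y -> spans k A [set y].
  by move=> y ys; apply: sp; rewrite /= inE (ys : y \in s) orbT.
have -> : [set` x :: s] = [set x] `|` [set` s].
  apply/seteqP; split => y; rewrite /= inE; first by move=> /predU1P[->|]; [left|right].
  by move=> [->|ys]; rewrite ?eqxx// (ys : y \in s) orbT.
by apply: spansU => //; apply: sp; rewrite /= inE eqxx.
Qed.

Lemma polymatroid_rank (E : Type) (f : set E -> R) : polymatroid f -> rank_fun f.
Proof. by case. Qed.

(** Finite type reduces an infinite [B], such as a whole line, to the finite parts of the union,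
    each of rank at most [f A]. *)
Lemma spans_finite_type (E : Type) (f : set E -> R) (A B : set E) :
  polymatroid f -> (forall x, B x -> spans f A [set x]) -> spans f A B.
Proof.
move=> fp sp; have ff := polymatroid_rank fp.
apply: spans_le => //; have [_ _ _ /(_ (A `|` B)) ->] := fp.
apply: (@finitary_le _ _ f ff) => F fF FAB.
have sF : spans f A (F `&` B).
  by apply: spans_fin => //; [exact: finite_setIl|move=> x [_ /sp]].
rewrite -[leRHS]sF; apply: rank_mono => // x Fx.
by have [Ax|Bx] := FAB x Fx; [left|right].
Qed.

Lemma rank_fun_pullback (E E' : Type) (k : E' -> E) (h : set E -> R) :
  rank_fun h -> rank_fun (fun A => h (k @` A)).
Proof.
move=> hh; split; first by rewrite image_set0 rank_set0.
- by move=> A B AB; apply: rank_mono => //; exact: image_subset.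
- move=> A B; rewrite image_setU; have := rank_submod hh (k @` A) (k @` B).
  have := rank_mono hh (@sub_image_setI _ _ k A B); lra.
Qed.

Lemma rank_fun_contract (E : Type) (h : set E -> R) (Z : set E) :
  rank_fun h -> rank_fun (rank_contract h Z).
Proof.
move=> hh; rewrite /rank_contract; split; first by rewrite set0U subrr.
- by move=> A B AB; rewrite lerD2r; apply: rank_mono => //; exact: setSU.
- move=> A B; have := rank_submod hh (A `|` Z) (B `|` Z).
  by rewrite -setUIl setUACA setUid; lra.
Qed.

Lemma spans_contract (E : Type) (h : set E -> R) (Z A B : set E) :
  rank_fun h -> spans h A B -> spans (rank_contract h Z) A B.
Proof.
move=> hh /(spansW hh (@subsetUl _ A Z)) sp; rewrite /spans /rank_contract.
by rewrite setUAC sp.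
Qed.

Lemma rank_contract_le (E : Type) (h : set E -> R) (Z A : set E) :
  rank_fun h -> rank_contract h Z A <= h A.
Proof. by move=> hh; rewrite /rank_contract; have := rankU hh A Z; lra. Qed.

Lemma spans_image (E E' : Type) (f : set E -> R) (h : set E' -> R) (n : E -> E')
    (A B : set E) : (forall C, h (n @` C) = f C) ->
  spans f A B -> spans h (n @` A) (n @` B).
Proof. by move=> hn; rewrite /spans -image_setU !hn. Qed.

Definition parallel (E : Type) (h : set E -> R) (x y : E) : Prop :=
  spans h [set x] [set y] /\ spans h [set y] [set x].

Lemma parallel_refl (E : Type) (h : set E -> R) (x : E) : parallel h x x.
Proof. by split; rewrite /spans setUid. Qed.

End Spanning.

Ltac set_mem_tauto := rewrite /setI /setU /set1 /mkset /=; tauto.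

Ltac set_tauto := let x := fresh in move=> x; set_mem_tauto.

(** * Lines, collinear triples and the fourth face of a tetrahedron *)

Section Edges.
Context {R : realType} (E : Type) (h : set E -> R).
Hypothesis hh : rank_fun h.
Implicit Types (u v w x y z : E).

Lemma spans_parallel (x y z x' y' z' : E) :
  parallel h x x' -> parallel h y y' -> parallel h z z' ->
  spans h [set x; y] [set z] -> spans h [set x'; y'] [set z'].
Proof.
move=> [_ x'x] [_ y'y] [zz' _] sp; apply: (spans_trans hh) zz'.
apply: (spans_trans hh) sp; apply: (spansU hh).
  by apply: (spansW hh) x'x; set_tauto.
by apply: (spansW hh) y'y; set_tauto.
Qed.

(** Spanning conditions, unlike ranks, survive contraction and the exchange of parallel elements.
    The ranks demanded of a geometry are recovered from them once the basis is known to be free. *)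
Definition on_line (u v x : E) : Prop :=
  [/\ spans h [set u; v] [set x], spans h [set u; x] [set v] &
      spans h [set v; x] [set u]].

Lemma on_lineC u v x : on_line u v x -> on_line v u x.
Proof. by case=> ? ? ?; split => //; rewrite setUC. Qed.

Lemma on_line_parallel u v x u' v' x' :
  parallel h u u' -> parallel h v v' -> parallel h x x' ->
  on_line u v x -> on_line u' v' x'.
Proof. by move=> pu pv px [? ? ?]; split; apply: spans_parallel; eassumption. Qed.

Definition collinear x y z : Prop :=
  [/\ spans h [set x; y] [set z], spans h [set x; z] [set y] &
      spans h [set y; z] [set x]].

Lemma collinear_parallel x y z x' y' z' :
  parallel h x x' -> parallel h y y' -> parallel h z z' ->
  collinear x y z -> collinear x' y' z'.
Proof. by move=> px py pz [? ? ?]; split; apply: spans_parallel; eassumption. Qed.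

Lemma rank2_le x y : h [set x] <= 1 -> h [set y] <= 1 -> h [set x; y] <= 2.
Proof. by move=> ? ?; have := rankU hh [set x] [set y]; lra. Qed.

Lemma rank3_le x y z : h [set x] <= 1 -> h [set y] <= 1 -> h [set z] <= 1 ->
  h [set x; y; z] <= 3.
Proof.
by move=> ? ? ?; have := rankU hh [set x; y] [set z]; have := @rank2_le x y; lra.
Qed.

Lemma on_line_rank2 u v x : h [set u; v] = 2 -> h [set u] <= 1 ->
  h [set x] <= 1 -> on_line u v x -> h [set u; x] = 2.
Proof.
move=> uv u1 x1 [_ sp _]; apply/le_anti; rewrite rank2_le//= -uv.
apply: spans_rank => //; apply: spansU => //; apply: spans_sub => //; set_tauto.
Qed.

Lemma on_line_rank1 u v x : h [set u; v] = 2 -> h [set u] <= 1 ->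
  h [set x] <= 1 -> on_line u v x -> h [set x] = 1.
Proof.
move=> uv u1 x1 uvx; have := on_line_rank2 uv u1 x1 uvx.
have := rankU hh [set u] [set x]; lra.
Qed.

(** Together with the common vertex [v], the elements [x] and [y] span the plane, so their rank is
    at least [3 - 1]. *)
Lemma two_lines_rank u v w x y : h [set u; v; w] = 3 -> h [set v] <= 1 ->
  h [set x] <= 1 -> h [set y] <= 1 ->
  on_line u v x -> on_line w v y -> h [set x; y] = 2.
Proof.
move=> uvw v1 x1 y1 [_ _ sx] [_ _ sy]; apply/le_anti; rewrite rank2_le//=.
have := rankU hh [set x; y] [set v].
suff : h [set u; v; w] <= h ([set x; y] `|` [set v]) by lra.
apply: spans_rank => //; apply: spansU => //; [apply: spansU => //|].
- by apply: (spansW hh) sx; set_tauto.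
- by apply: spans_sub => //; set_tauto.
- by apply: (spansW hh) sy; set_tauto.
Qed.

Lemma rank2_collinear x y z : h [set x; y; z] = 2 ->
  h [set x; y] = 2 -> h [set x; z] = 2 -> h [set y; z] = 2 -> collinear x y z.
Proof.
move=> xyz xy xz yz; split; rewrite /spans ?xy ?xz ?yz -xyz //; congr h;
  by apply/seteqP; split; set_tauto.
Qed.

(* [x], [y] and [w] lie both in the plane spanned by [x], [q1], [q2] and in the plane
   spanned by [i], [j], [k]; these two planes together span rank 4. *)
Lemma tetrahedron o i j k x y w q1 q2 z :
  4 <= h [set o; i; j; k] ->
  (forall a, [set o; i; j; k; x; y; q1; q2] a -> h [set a] <= 1) ->
  on_line i j x -> on_line k j y -> on_line k i w ->
  on_line i o q1 -> on_line k o q2 ->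
  spans h [set q1; q2] [set w] -> spans h [set q1; x] [set z] ->
  spans h [set q2; z] [set y] ->
  h [set x; y; w] = 2.
Proof.
move=> r4 le1 ijx kjy kiw ioq1 koq2 s1 s2 s3.
have [[[ijx1 ijx2 ijx3] [kjy1 kjy2 kjy3]] [kiw1 kiw2 kiw3]] := (ijx, kjy, kiw).
have [[io1 io2 io3] [ko1 ko2 ko3]] := (ioq1, koq2).
have lo : h [set o] <= 1 by apply: le1; set_mem_tauto.
have li : h [set i] <= 1 by apply: le1; set_mem_tauto.
have lj : h [set j] <= 1 by apply: le1; set_mem_tauto.
have lk : h [set k] <= 1 by apply: le1; set_mem_tauto.
have lx : h [set x] <= 1 by apply: le1; set_mem_tauto.
have lq1 : h [set q1] <= 1 by apply: le1; set_mem_tauto.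
have lq2 : h [set q2] <= 1 by apply: le1; set_mem_tauto.
have lower : 2 <= h [set x; y; w].
  have xy : h [set x; y] <= h [set x; y; w] by apply: rank_mono => //; set_tauto.
  have : h [set o; i; j; k] <= h ([set x; y] `|` [set j; o]).
    apply: spans_rank => //; do ?apply: spansU => //.
    - by apply: spans_sub => //; set_tauto.
    - by apply: (spansW hh) ijx3; set_tauto.
    - by apply: spans_sub => //; set_tauto.
    - by apply: (spansW hh) kjy3; set_tauto.
  have := rankU hh [set x; y] [set j; o]; have := rank2_le lj lo; lra.
(* The three faces at [o] act in turn: [w] is spanned by [q1], [q2], then [z] by [q1], [x], and
   finally [y] by [q2], [z]. *)
have A3 : h [set x; y; q1; q2; w] <= 3.
  apply: le_trans (rank3_le lx lq1 lq2); apply: spans_rank => //.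
  have sz : spans h [set x; q1; q2] [set z] by apply: (spansW hh) s2; set_tauto.
  have sy : spans h [set x; q1; q2] [set y].
    by apply: (spans_add hh sz); apply: (spansW hh) s3; set_tauto.
  have sw : spans h [set x; q1; q2] [set w] by apply: (spansW hh) s1; set_tauto.
  by do ?apply: spansU => //; apply: spans_sub => //; set_tauto.
have B3 : h [set x; y; i; k; w] <= 3.
  apply: le_trans (rank3_le li lj lk); apply: spans_rank => //.
  do ?apply: spansU => //.
  - by apply: (spansW hh) ijx1; set_tauto.
  - by apply: (spansW hh) kjy1; set_tauto.
  - by apply: spans_sub => //; set_tauto.
  - by apply: spans_sub => //; set_tauto.
  - by apply: (spansW hh) kiw1; set_tauto.
(* The upper bound is [3 + 3 - 4]. *)
have := rank_submod hh [set x; y; q1; q2; w] [set x; y; i; k; w].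
have : h [set o; i; j; k] <=
    h ([set x; y; q1; q2; w] `|` [set x; y; i; k; w]).
  apply: spans_rank => //; do ?apply: spansU => //.
  - by apply: (spansW hh) io2; set_tauto.
  - by apply: spans_sub => //; set_tauto.
  - by apply: (spansW hh) ijx2; set_tauto.
  - by apply: spans_sub => //; set_tauto.
have : h [set x; y; w] <= h ([set x; y; q1; q2; w] `&` [set x; y; i; k; w]).
  by apply: rank_mono => //; set_tauto.
by move=> ? ? ?; apply/le_anti/andP; split; lra.
Qed.

End Edges.

(** * Partial Dowling geometries *)

Section Free.
Context {R : realType} {E : Type} {r : nat} {h : set E -> R} {b : 'I_r -> E}.
Hypothesis b_free : forall A : {set 'I_r}, h (b @` [set` A]) = #|A|%:R.

Lemma free_rank1 i : h [set b i] = 1.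
Proof.
have -> : [set b i] = b @` [set` [set i]%SET].
  by rewrite -image_set1; congr image; apply/seteqP; split => k; rewrite /= inE => /eqP.
by rewrite b_free cards1.
Qed.

Lemma free_rank2 i j : i != j -> h [set b i; b j] = 2.
Proof.
move=> ij; have -> : [set b i; b j] = b @` [set` [set i; j]%SET].
  apply/seteqP; split => [x [->|->]|x [k]].
  - by exists i => //=; rewrite !inE eqxx.
  - by exists j => //=; rewrite !inE eqxx orbT.
  - by rewrite /= !inE => /orP[] /eqP -> <-; [left|right].
by rewrite b_free cards2 ij.
Qed.

Lemma free_rank3 i j k : i != j -> j != k -> i != k -> h [set b i; b j; b k] = 3.
Proof.
move=> ij jk ik; have -> : [set b i; b j; b k] = b @` [set` (k |: [set i; j])%SET].
  apply/seteqP; split => [x [[->|->]|->]|x [l]].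
  - by exists i => //=; rewrite !inE eqxx orbT.
  - by exists j => //=; rewrite !inE eqxx !orbT.
  - by exists k => //=; rewrite !inE eqxx.
  - by rewrite /= !inE => /or3P[] /eqP -> <-; [right|left; left|left; right].
by rewrite b_free cardsU1 !inE negb_or [k == i]eq_sym [k == j]eq_sym ik jk cards2 ij.
Qed.

End Free.

Section PDGFacts.
Context {R : realType} {S : genSet} {r : nat}.

Lemma dowling_eltV (E : Type) (c : 'I_r -> 'I_r -> S -> E) (i j : 'I_r) (s : S) :
  i != j -> dowling_elt c j i (gen_inv s) = dowling_elt c i j s.
Proof.
rewrite /dowling_elt -val_eqE /=; case: ltngtP => //= ij _.
by rewrite gen_invK.
Qed.

Variable P : PDG R S r.
Let f := @pdg_f R S r P.
Let b := pdg_b P.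

Lemma pdg_rank_fun : rank_fun f.
Proof. exact/polymatroid_rank/pdg_polymatroid. Qed.
Let ff := pdg_rank_fun.

Lemma pdg_b_rank1 i : f [set b i] = 1.
Proof. exact: (free_rank1 (pdg_b_free P)). Qed.

Lemma pdg_b_rank2 i j : i != j -> f [set b i; b j] = 2.
Proof. exact: (free_rank2 (pdg_b_free P)). Qed.

Lemma pdg_b_rank3 i j k : i != j -> j != k -> i != k -> f [set b i; b j; b k] = 3.
Proof. exact: (free_rank3 (pdg_b_free P)). Qed.

Lemma pdg_b_span : spans f (range b) setT.
Proof.
apply: spans_finite_type; first exact: pdg_polymatroid.
move=> x _; have [[i ->]|[i [j [s [ij ->]]]]] := pdg_cover x.
  by apply: spans_sub; [exact: ff|move=> _ ->; exists i].
have ij' : i != j by rewrite -val_eqE /= ltn_eqF.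
have := pdg_s_cl P s ij'; rewrite /pdg_s /dowling_elt ij => cl.
by apply: spansW cl; [exact: ff|move=> _ [->|->]; [exists i|exists j]].
Qed.

Lemma pdg_b_rankT : f (range b) = r%:R.
Proof.
have := pdg_b_free P [set: 'I_r]%SET; rewrite cardsT card_ord => <-; congr f.
by apply/seteqP; split => _ [i _ <-]; exists i => //=; rewrite inE.
Qed.

Lemma pdg_rankT : f setT = r%:R.
Proof. by rewrite -pdg_b_rankT -pdg_b_span setUT. Qed.

Lemma pdg_on_line i j s : i != j -> on_line f (b i) (b j) (pdg_s P i j s).
Proof.
have fwd k l t : k != l -> spans f [set b k; pdg_s P k l t] [set b l].
  move=> kl; have cl : f ([set b k; b l] `|` [set pdg_s P k l t]) = f [set b k; b l].
    exact: pdg_s_cl.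
  by rewrite /spans setUAC cl pdg_b_rank2// [RHS]pdg_bs_rank.
move=> ij; split; first exact: pdg_s_cl.
  exact: fwd.
by rewrite /pdg_s -(dowling_eltV _ _ ij); apply: fwd; rewrite eq_sym.
Qed.

(** Any two of the elements lie on lines sharing a vertex and thus have rank 2, which is also the
    rank of the triple. Writing the inverse on the line from [j] to [k] as [s] on the line from [k]
    to [j] makes the triple symmetric in [i] and [k]. *)
Lemma pdg_collinear i j k s : i != j -> j != k -> i != k ->
  collinear f (pdg_s P i j s) (pdg_s P k j s) (pdg_s P k i (gen_e S)).
Proof.
move=> ij jk ik; have [ji kj ki] : [/\ j != i, k != j & k != i].
  by rewrite ![_ == j]eq_sym ![k == _]eq_sym; rewrite eq_sym ij jk ik.
have kjE : pdg_s P j k (gen_inv s) = pdg_s P k j s by exact: dowling_eltV.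
have rk1 x y t : x != y -> f [set pdg_s P x y t] <= 1.
  by move=> xy; rewrite /f pdg_s_rank.
have bk1 x : f [set b x] <= 1 by rewrite pdg_b_rank1.
apply: rank2_collinear.
- by rewrite -kjE; exact: pdg_triangle.
- apply: (@two_lines_rank _ _ _ ff (b i) (b j) (b k)); rewrite ?rk1 ?pdg_b_rank3//;
    exact: pdg_on_line.
- apply: (@two_lines_rank _ _ _ ff (b j) (b i) (b k)); rewrite ?rk1 ?pdg_b_rank3//;
    last exact: pdg_on_line.
  by apply: on_lineC; exact: pdg_on_line.
- apply: (@two_lines_rank _ _ _ ff (b j) (b k) (b i)); rewrite ?rk1 ?pdg_b_rank3//;
    apply: on_lineC; exact: pdg_on_line.
Qed.

End PDGFacts.

(** * Assembling a geometry from a frame *)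

Section PDGBuild.
Context {R : realType} {S : genSet} {r : nat}.

(** Labels are distinct by construction, so disjointness of the copies need not be checked in the
    ambient type. *)
Definition dowling_ground : Type :=
  ('I_r + {p : 'I_r * 'I_r | (p.1 < p.2)%N} * S)%type.

(* Junk value [inl i] unless [i < j]. *)
Definition ground_copy (i j : 'I_r) (s : S) : dowling_ground :=
  if insub (i, j) is Some p then inr (p, s) else inl i.

Lemma ground_copyE (i j : 'I_r) (s : S) (ij : (i < j)%N) :
  ground_copy i j s = inr (Sub (i, j) ij, s).
Proof. by rewrite /ground_copy insubT. Qed.

Variables (E : Type) (h : set E -> R) (b : 'I_r -> E) (c : 'I_r -> 'I_r -> S -> E).

Definition ground_map (x : dowling_ground) : E :=
  match x with inl i => b i | inr (p, s) => c (val p).1 (val p).2 s end.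

Definition ground_fun : set dowling_ground -> R :=
  finitary (fun A => h (ground_map @` A)).

Hypothesis hh : rank_fun h.
Let s_ := dowling_elt c.
Hypothesis b_free : forall A : {set 'I_r}, h (b @` [set` A]) = #|A|%:R.
Hypothesis s_on_line : forall i j s, i != j -> on_line h (b i) (b j) (s_ i j s).
Hypothesis s_rank : forall i j s, i != j -> h [set s_ i j s] <= 1.
Hypothesis s_triangle : forall i j k s, i != j -> j != k -> i != k ->
  h [set s_ i j s; s_ k j s; s_ k i (gen_e S)] = 2.

Lemma ground_map_s i j s : i != j ->
  ground_map (dowling_elt ground_copy i j s) = s_ i j s.
Proof.
rewrite /s_ /dowling_elt -val_eqE /=; case: ltngtP => //= ij _.
  by rewrite ground_copyE.
by rewrite ground_copyE.
Qed.

Let kk : rank_fun (fun A => h (ground_map @` A)) := rank_fun_pullback ground_map hh.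

(** Transparent, because the embedding constructed in [core_extends] computes with its ground type
    and its labels. *)
Definition pdg_of_frame : PDG R S r.
Proof.
refine (@MkPDG R S r dowling_ground ground_fun inl ground_copy _ _ _ _ _ _ _ _ _ _).
- exact: polymatroid_finitary.
- by move=> i j [].
- move=> A; rewrite /ground_fun finitary_fin//; last exact: finite_image.
  by rewrite image_comp; exact: b_free.
- move=> i j k l s t ij kl; rewrite !ground_copyE => -[ijE jlE <-].
  by split.
- by move=> i j k s ij; rewrite ground_copyE.
- case=> [i|[[[i j] /= ij] s]]; [left|right]; first by exists i.
  by exists i, j, s; rewrite ground_copyE;
    split => //; congr (inr (_, _)); exact: val_inj.
- move=> i j s ij; have [sp _ _] := s_on_line s ij.
  rewrite /cl /= /ground_fun !finitary_fin//.
  by rewrite !image_setU !image_set1 ground_map_s//=.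
- move=> i j s ij; rewrite /ground_fun finitary_fin// image_set1 ground_map_s//.
  by apply: (on_line_rank1 hh (free_rank2 b_free ij));
    rewrite ?(free_rank1 b_free) ?s_rank//; exact: s_on_line.
- move=> i j s ij; rewrite /ground_fun finitary_fin// image_setU !image_set1.
  rewrite ground_map_s//.
  by apply: (on_line_rank2 hh (free_rank2 b_free ij));
    rewrite ?(free_rank1 b_free) ?s_rank//; exact: s_on_line.
- move=> i j k s ij jk ik; rewrite /ground_fun finitary_fin//.
  rewrite !image_setU !image_set1 !ground_map_s//; last by rewrite eq_sym.
  by rewrite /s_ (dowling_eltV c s) ?s_triangle// eq_sym.
Defined.

End PDGBuild.

(** * Two copies of a geometry of rank 3 *)

Definition v0 : 'I_3 := @Ordinal 3 0 isT.
Definition v1 : 'I_3 := @Ordinal 3 1 isT.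
Definition v2 : 'I_3 := @Ordinal 3 2 isT.

Lemma ord3_ind (T : 'I_3 -> Prop) : T v0 -> T v1 -> T v2 -> forall i, T i.
Proof.
move=> t0 t1 t2 [[|[|[|//]]] hi].
- by rewrite (_ : Ordinal hi = v0) //; exact: val_inj.
- by rewrite (_ : Ordinal hi = v1) //; exact: val_inj.
- by rewrite (_ : Ordinal hi = v2) //; exact: val_inj.
Qed.

Definition pdg_line (R : realType) (S : genSet) (r : nat) (P : PDG R S r)
    (i j : 'I_r) : set P :=
  [set pdg_b P i; pdg_b P j] `|` range (pdg_copy P i j).
Arguments pdg_line {R S r} P i j _.

Section TwoCopies.
Context {R : realType} {S : genSet}.

Lemma pdg_line_rank (r : nat) (P : PDG R S r) (i j : 'I_r) : (i < j)%N ->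
  pdg_f (pdg_line P i j) = 2.
Proof.
move=> ij; have ij' : i != j by rewrite -val_eqE /= ltn_eqF.
rewrite -(pdg_b_rank2 P ij'); apply: spans_finite_type (pdg_polymatroid P) _.
move=> _ [s _ <-]; have [sp _ _] := pdg_on_line P s ij'.
by move: sp; rewrite /pdg_s /dowling_elt ij.
Qed.

(* [m a b] embeds [P]; [a] selects one of two copies of the second vertex and
   [b] one of two copies of the third vertex. *)
Lemma two_copies (P : PDG R S 3) : closure_entropic (@pdg_f R S 3 P) ->
  exists (E : Type) (h : set E -> R) (m : bool -> bool -> P -> E),
  [/\ closure_entropic h,
      forall a b A, h (m a b @` A) = pdg_f A,
      forall a b b' x, pdg_line P v0 v1 x -> m a b x = m a b' x,
      forall a a' b x, pdg_line P v0 v2 x -> m a b x = m a' b x &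
      5 <= h [set m false false (pdg_b P v0); m false false (pdg_b P v1);
              m false false (pdg_b P v2); m false true (pdg_b P v2);
              m true false (pdg_b P v1)]].
Proof.
move=> cf; set f := @pdg_f R S 3 P.
have [h1 [ch1 h1l h1r h1T h1D]] := closure_entropic_copy (pdg_line P v0 v1) cf.
set psi1 := second_copy (pdg_line P v0 v1) in h1r h1D.
pose Y := pdg_line P v0 v2; pose X := inl @` Y `|` psi1 @` Y.
have [h [ch hl hr hT hD]] := closure_entropic_copy X ch1.
set psi2 := second_copy X in hr hD.
pose m (a b : bool) (x : P) :=
  (if a then psi2 else inl) ((if b then psi1 else inl) x).
have psi1_line x : pdg_line P v0 v1 x -> psi1 x = inl x.
  by move=> xl; rewrite /psi1 /second_copy mem_set.
have psi2_line x : X x -> psi2 x = inl x.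
  by move=> xX; rewrite /psi2 /second_copy mem_set.
have hm a b A : h (m a b @` A) = f A.
  rewrite (_ : m a b = (if a then psi2 else inl) \o (if b then psi1 else inl))//.
  by rewrite -image_comp; case: a; case: b; rewrite ?hl ?hr ?h1l ?h1r.
have m1 a b b' x : pdg_line P v0 v1 x -> m a b x = m a b' x.
  by move=> xl; rewrite /m; case: b; case: b'; rewrite ?psi1_line.
have m2 a a' b x : pdg_line P v0 v2 x -> m a b x = m a' b x.
  move=> xl; have bX : X ((if b then psi1 else inl) x).
    by case: b; [right|left]; exists x.
  by rewrite /m; case: a; case: a'; rewrite ?psi2_line.
exists ((P + P) + (P + P))%type, h, m; split => //.
have rh1 := closure_entropic_rank ch1; have rh := closure_entropic_rank ch.
(* Two planes glued along a line: [2 * 3 - 2]. *)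
have h1T4 : h1 setT = 4.
  by rewrite h1T pdg_rankT pdg_line_rank//; lra.
(* Two lines sharing b1: at most [2 + 2 - 1]. *)
have h1X : h1 X <= 3.
  have := rank_submod rh1 (inl @` Y) (psi1 @` Y); rewrite h1l h1r pdg_line_rank//.
  have : h1 (inl @` [set pdg_b P v0]) <= h1 (inl @` Y `&` psi1 @` Y).
    apply: rank_mono => // _ [_ -> <-]; split.
      by exists (pdg_b P v0) => //; left; left.
    exists (pdg_b P v0); first by left; left.
    by apply: psi1_line; left; left.
  by rewrite h1l /X pdg_b_rank1; lra.
set B := [set _; _; _; _; _].
have b01 i : i != v2 -> pdg_line P v0 v1 (pdg_b P i).
  by elim/ord3_ind: i => // _; left; [left|right].
have b02 i : i != v1 -> pdg_line P v0 v2 (pdg_b P i).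
  by elim/ord3_ind: i => // _; left; [left|right].
have mB a b i : B (m a b (pdg_b P i)).
  rewrite /B; elim/ord3_ind: i.
  - rewrite (m1 _ _ false _ (b01 v0 isT)) (m2 _ false _ _ (b02 v0 isT)).
    by do 4 left.
  - rewrite (m1 _ _ false _ (b01 v1 isT)); case: a; first by right.
    by do 3 left; right.
  - rewrite (m2 _ false _ _ (b02 v2 isT)); case: b; first by left; right.
    by do 2 left; right.
have spm a b : spans h B (range (m a b)).
  apply: (spansW rh) (spans_image (hm a b) (pdg_b_span P)).
  by move=> _ [_ [i _ <-] <-]; exact: mB.
have sp1 : spans h1 (range inl `|` range psi1) setT by rewrite /spans setUT.
(* The five vertices span the four planes [m a b], and these planes span both copies of the first
   double. *)
have spT : spans h B setT.
  apply: (spans_trans rh (B := range inl `|` range psi2)); last by rewrite /spans setUT.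
  apply: (spansU rh).
    apply: (spans_trans rh) (spans_image hl sp1).
    rewrite image_setU !image_comp; apply: (spansU rh); first exact: (spm false false).
    exact: (spm false true).
  apply: (spans_trans rh) (spans_image hr sp1).
  rewrite image_setU !image_comp; apply: (spansU rh); first exact: (spm true false).
  exact: (spm true true).
(* The total is at least [2 * 4 - 3]. *)
rewrite -[leRHS]spT setUT hT h1T4; lra.
Qed.

End TwoCopies.

(** * The geometry of rank 4 *)

(** The cardinality bounds the rank of a set and of its complement, and the two cardinalities add up
    to [r], so there is no slack. *)
Lemma free_of_rank (R : realType) (E : Type) (r : nat) (h : set E -> R)
    (b : 'I_r -> E) : rank_fun h -> (forall i, h [set b i] <= 1) ->
  r%:R <= h (range b) ->
  forall A : {set 'I_r}, h (b @` [set` A]) = #|A|%:R.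
Proof.
move=> hh b1 br.
have upper (A : {set 'I_r}) : h (b @` [set` A]) <= #|A|%:R.
  elim: {A}_.+1 {-2}A (ltnSn #|A|) => // n IHn A.
  have [->|[i iA]] := set_0Vmem A.
    move=> _; rewrite cards0 (_ : [set` _] = set0) ?image_set0 ?rank_set0//.
    by apply/seteqP; split => // x; rewrite /= inE.
  rewrite (cardsD1 i A) iA ltnS => /IHn IH.
  have : h (b @` [set` A]) <= h ([set b i] `|` b @` [set` (A :\ i)%SET]).
    apply: rank_mono => // _ [x /= xA <-]; have [->|xi] := eqVneq x i; first by left.
    by right; exists x => //=; rewrite !inE xi.
  have := rankU hh [set b i] (b @` [set` (A :\ i)%SET]); have := b1 i.
  rewrite natrD /=; lra.
move=> A; apply/le_anti; rewrite upper /=.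
have : h (range b) <= h (b @` [set` A] `|` b @` [set` (~: A)%SET]).
  apply: rank_mono => // _ [x _ <-]; have [xA|xA] := boolP (x \in A).
    by left; exists x.
  by right; exists x => //=; rewrite inE.
have := rankU hh (b @` [set` A]) (b @` [set` (~: A)%SET]); have := upper (~: A)%SET.
have : r%:R = #|A|%:R + #|(~: A)%SET|%:R :> R by rewrite -natrD cardsC card_ord.
lra.
Qed.

Definition u0 : 'I_4 := @Ordinal 4 0 isT.
Definition u1 : 'I_4 := @Ordinal 4 1 isT.
Definition u2 : 'I_4 := @Ordinal 4 2 isT.
Definition u3 : 'I_4 := @Ordinal 4 3 isT.

Lemma ord4_ind (T : 'I_4 -> Prop) : T u0 -> T u1 -> T u2 -> T u3 -> forall i, T i.
Proof.
move=> t0 t1 t2 t3 [[|[|[|[|//]]]] hi].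
- by rewrite (_ : Ordinal hi = u0) //; exact: val_inj.
- by rewrite (_ : Ordinal hi = u1) //; exact: val_inj.
- by rewrite (_ : Ordinal hi = u2) //; exact: val_inj.
- by rewrite (_ : Ordinal hi = u3) //; exact: val_inj.
Qed.

(* The three faces [u0 u1 u2], [u0 u1 u3] and [u0 u3 u2] of the tetrahedron. *)
Definition face (t x : 'I_3) : 'I_4 :=
  match (x : nat), (t : nat) with
  | 0, _ => u0
  | 1, (0 | 1) => u1
  | 1, _ => u3
  | _, (0 | S (S _)) => u2
  | _, _ => u3
  end.

Lemma face_cover (i j k : 'I_4) : i != j -> j != k -> i != k ->
  [|| i == u0, j == u0 | k == u0] ->
  exists t x y w, [/\ i = face t x, j = face t y & k = face t w].
Proof.
by elim/ord4_ind: i; elim/ord4_ind: j => //; elim/ord4_ind: k => // _ _ _ _;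
first [ by exists v0, v0, v1, v2 | by exists v0, v0, v2, v1
      | by exists v0, v1, v0, v2 | by exists v0, v1, v2, v0
      | by exists v0, v2, v0, v1 | by exists v0, v2, v1, v0
      | by exists v1, v0, v1, v2 | by exists v1, v0, v2, v1
      | by exists v1, v1, v0, v2 | by exists v1, v1, v2, v0
      | by exists v1, v2, v0, v1 | by exists v1, v2, v1, v0
      | by exists v2, v0, v1, v2 | by exists v2, v0, v2, v1
      | by exists v2, v1, v0, v2 | by exists v2, v1, v2, v0
      | by exists v2, v2, v0, v1 | by exists v2, v2, v1, v0 ].
Qed.

Lemma face_cover2 (i j : 'I_4) : i != j ->
  exists t x y, i = face t x /\ j = face t y.
Proof.
have other (k : 'I_4) : i != j -> j != k -> i != k ->
    [|| i == u0, j == u0 | k == u0] -> exists t x y, i = face t x /\ j = face t y.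
  by move=> ij jk ik /(face_cover ij jk ik)[t [x [y [w [-> -> _]]]]]; exists t, x, y.
move=> ij; have [i0|i0] := eqVneq i u0; last first.
  have [j0|j0] := eqVneq j u0; last by apply: (other u0); rewrite ?eqxx ?orbT.
  have [i1|i1] := eqVneq i u1.
    by apply: (other u2) => //; rewrite ?i1 ?j0 ?eqxx ?orbT.
  by apply: (other u1) => //; rewrite ?j0 ?eqxx ?orbT.
have [j1|j1] := eqVneq j u1.
  by apply: (other u2) => //; rewrite ?j1 ?i0.
by apply: (other u1) => //; rewrite i0.
Qed.

(** * Contraction of e45 in the double copy *)

Section Core.
Context {R : realType} {S : genSet} (P : PDG R S 3) (E : Type) (h : set E -> R).
Context (m : bool -> bool -> P -> E).
Hypothesis hh : rank_fun h.
Hypothesis hm : forall a b A, h (m a b @` A) = pdg_f A.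
Hypothesis m1 : forall a b b' x, pdg_line P v0 v1 x -> m a b x = m a b' x.
Hypothesis m2 : forall a a' b x, pdg_line P v0 v2 x -> m a b x = m a' b x.

Let bP := pdg_b P.
Let cP := pdg_copy P.
Let sP := @pdg_s R S 3 P.

Hypothesis rank5 : 5 <= h [set m false false (bP v0); m false false (bP v1);
  m false false (bP v2); m false true (bP v2); m true false (bP v1)].

(* e45; the map [m true true] embeds the plane 154. *)
Definition core_z : E := m true true (cP v1 v2 (gen_e S)).

Definition core_rank : set E -> R := rank_contract h [set core_z].

Definition core_b (i : 'I_4) : E :=
  match (i : nat) with
  | 0 => m false false (bP v0)
  | 1 => m false false (bP v1)
  | 2 => m false false (bP v2)
  | _ => m false true (bP v2)
  end.

(* The last line is s35, which runs from the third to the second vertex of [P] and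
   is therefore inverted. The values for [i >= j] are junk. *)
Definition core_c (i j : 'I_4) (s : S) : E :=
  match (i : nat), (j : nat) with
  | 0, (0 | 1) => m false false (cP v0 v1 s)
  | 0, 2 => m false false (cP v0 v2 s)
  | 0, _ => m false true (cP v0 v2 s)
  | 1, (0 | 1 | 2) => m false false (cP v1 v2 s)
  | 1, _ => m false true (cP v1 v2 s)
  | _, _ => m true false (cP v1 v2 (gen_inv s))
  end.

Let k := core_rank.
Let s_ := dowling_elt core_c.

Lemma core_rank_fun : rank_fun k.
Proof. exact: rank_fun_contract. Qed.
Let kk := core_rank_fun.

Let b01 i : i != v2 -> pdg_line P v0 v1 (bP i).
Proof. by elim/ord3_ind: i => // _; left; [left|right]. Qed.

Let b02 i : i != v1 -> pdg_line P v0 v2 (bP i).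
Proof. by elim/ord3_ind: i => // _; left; [left|right]. Qed.

Let c01 s : pdg_line P v0 v1 (cP v0 v1 s).
Proof. by right; exists s. Qed.

Let c02 s : pdg_line P v0 v2 (cP v0 v2 s).
Proof. by right; exists s. Qed.

Let hm1 a b x : h [set m a b x] = pdg_f [set x].
Proof. by rewrite -(hm a b) image_set1. Qed.

Let spans_m a b x y w : spans (@pdg_f R S 3 P) [set x; y] [set w] ->
  spans k [set m a b x; m a b y] [set m a b w].
Proof.
move=> sp; apply: spans_contract => //.
by have := spans_image (hm a b) sp; rewrite image_setU !image_set1.
Qed.

Let on_line_m a b x y w :
  on_line (@pdg_f R S 3 P) x y w -> on_line k (m a b x) (m a b y) (m a b w).
Proof. by move=> [? ? ?]; split; exact: spans_m. Qed.

Let collinear_m a b x y w :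
  collinear (@pdg_f R S 3 P) x y w -> collinear k (m a b x) (m a b y) (m a b w).
Proof. by move=> [? ? ?]; split; exact: spans_m. Qed.

Let z_loop A : spans k A [set core_z].
Proof.
by rewrite /spans /k /core_rank /rank_contract -setUA setUid.
Qed.

Let spans_z x y : spans k [set x; core_z] [set y] -> spans k [set x] [set y].
Proof. by apply: spans_add => //; exact: z_loop. Qed.

Let parallel_b : parallel k (m true false (bP v1)) (m false true (bP v2)).
Proof.
rewrite (m1 _ _ true (b01 (isT : v1 != v2))) (m2 _ true _ (b02 (isT : v2 != v1))).
have [_ l1 l2] := on_line_m true true (pdg_on_line P (gen_e S) (isT : v1 != v2)).
by split; apply: spans_z.
Qed.

(** The triangle condition in the plane 154 makes s15, s14 and e45 collinear. After contraction e45
    is a loop, and the other two span each other. *)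
Let parallel_c s : parallel k (m true false (cP v0 v1 s)) (m false true (cP v0 v2 s)).
Proof.
rewrite (m1 _ _ true (c01 s)) (m2 _ true _ (c02 s)).
have := pdg_collinear P (gen_inv s) (isT : v1 != v0) (isT : v0 != v2) (isT : v1 != v2).
rewrite /pdg_s /dowling_elt /= !gen_invK gen_inv_e.
by case/(collinear_m true true) => _ l1 l2; split; apply: spans_z.
Qed.

(** The third plane is embedded with b5 in place of b4, so it matches [core_b] and [core_c] only up
    to parallel elements. *)
Let face_copy (t : 'I_3) : P -> E :=
  match (t : nat) with 0 => m false false | 1 => m false true | _ => m true false end.

Let face_copy_m t : exists a b, face_copy t = m a b.
Proof.
elim/ord3_ind: t; rewrite /face_copy /=.
- by exists false, false.
- by exists false, true.
- by exists true, false.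
Qed.

Let face_b t x : parallel k (face_copy t (bP x)) (core_b (face t x)).
Proof.
elim/ord3_ind: t; rewrite /face_copy /=.
- by elim/ord3_ind: x; exact: parallel_refl.
- elim/ord3_ind: x; rewrite /core_b /=; last exact: parallel_refl.
    by rewrite (m1 _ _ false (b01 (isT : v0 != v2))); exact: parallel_refl.
  by rewrite (m1 _ _ false (b01 (isT : v1 != v2))); exact: parallel_refl.
- elim/ord3_ind: x; rewrite /core_b /=; last 2 first.
  + exact: parallel_b.
  + by rewrite (m2 _ false _ (b02 (isT : v2 != v1))); exact: parallel_refl.
  + by rewrite (m2 _ false _ (b02 (isT : v0 != v1))); exact: parallel_refl.
Qed.

Let face_s t x y s : x != y ->
  parallel k (face_copy t (sP x y s)) (s_ (face t x) (face t y) s).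
Proof.
elim/ord3_ind: t; elim/ord3_ind: x; elim/ord3_ind: y => // _;
  rewrite /face_copy /sP /pdg_s /s_ /dowling_elt /core_c /=;
  first [ exact: parallel_refl | exact: parallel_c
        | by rewrite (m1 _ _ false (c01 _)); exact: parallel_refl
        | by rewrite (m2 _ false _ (c02 _)); exact: parallel_refl
        | by rewrite gen_invK; exact: parallel_refl ].
Qed.

Lemma core_on_line i j s : i != j -> on_line k (core_b i) (core_b j) (s_ i j s).
Proof.
move=> /[dup] ij /face_cover2[t [x [y [iE jE]]]].
have xy : x != y by apply: contraNneq ij => xy; rewrite iE jE xy.
have [a [b mab]] := face_copy_m t.
have := on_line_m a b (pdg_on_line P s xy); rewrite -mab iE jE.
exact: (on_line_parallel kk (face_b t x) (face_b t y) (face_s t s xy)).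
Qed.

Lemma core_collinear i j l s : i != j -> j != l -> i != l ->
  [|| i == u0, j == u0 | l == u0] ->
  collinear k (s_ i j s) (s_ l j s) (s_ l i (gen_e S)).
Proof.
move=> ij jl il h0.
have [t [x [y [w [iE jE lE]]]]] := face_cover ij jl il h0.
have xy : x != y by apply: contraNneq ij => xy; rewrite iE jE xy.
have yw : y != w by apply: contraNneq jl => yw; rewrite jE lE yw.
have xw : x != w by apply: contraNneq il => xw; rewrite iE lE xw.
have [a [b mab]] := face_copy_m t.
have := collinear_m a b (pdg_collinear P s xy yw xw); rewrite -mab iE jE lE.
have [wy wx] : w != y /\ w != x by rewrite eq_sym yw eq_sym xw.
exact: (collinear_parallel kk (face_s t s xy) (face_s t s wy) (face_s t _ wx)).
Qed.

Let sP_rank1 (x y : 'I_3) s : (x < y)%N -> pdg_f [set cP x y s] = 1.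
Proof.
move=> xy; have := pdg_s_rank P s (_ : x != y); rewrite /pdg_s /dowling_elt xy.
by apply; rewrite -val_eqE /= ltn_eqF.
Qed.

Lemma core_b_le1 i : k [set core_b i] <= 1.
Proof.
apply: le_trans (rank_contract_le _ _ hh) _.
by elim/ord4_ind: i; rewrite /core_b /= hm1 pdg_b_rank1.
Qed.

Lemma core_s_le1 i j s : i != j -> k [set s_ i j s] <= 1.
Proof.
have le1 a b (x y : 'I_3) t : (x < y)%N -> k [set m a b (cP x y t)] <= 1.
  move=> xy; apply: le_trans (rank_contract_le _ _ hh) _.
  by rewrite hm1 sP_rank1.
by elim/ord4_ind: i; elim/ord4_ind: j => // _;
  rewrite /s_ /dowling_elt /core_c /=; exact: le1.
Qed.

Let z_rank1 : h [set core_z] = 1.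
Proof. by rewrite hm1 sP_rank1. Qed.

(** Since b4 and [core_z] span b5, adjoining [core_z] to b1, ..., b4 still gives rank at least 5, of
    which the contraction takes 1. *)
Lemma core_rank4 : 4 <= k [set core_b u0; core_b u1; core_b u2; core_b u3].
Proof.
rewrite /k /core_rank /rank_contract z_rank1 lerBrDr (le_trans _ (le_trans rank5 _))//.
  lra.
apply: spans_rank => //; apply: spansU => //.
  by apply: spans_sub => //; rewrite /core_b /=; set_tauto.
have sp : spans h [set m true true (bP v2); core_z] [set m true true (bP v1)].
  have [_ _ sp] := pdg_on_line P (gen_e S) (isT : v1 != v2).
  by have := spans_image (hm true true) sp; rewrite image_setU !image_set1.
rewrite (m1 _ _ true (b01 (isT : v1 != v2))); apply: (spansW hh) sp.
rewrite (m2 _ false _ (b02 (isT : v2 != v1))) /core_b /=; set_tauto.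
Qed.

Lemma core_b_free (A : {set 'I_4}) : k (core_b @` [set` A]) = #|A|%:R.
Proof.
apply: free_of_rank => //; first exact: core_b_le1.
apply: le_trans core_rank4 _; apply: rank_mono => // _ [[[->|->]|->]|->].
- by exists u0.
- by exists u1.
- by exists u2.
- by exists u3.
Qed.

Lemma core_triangle i j l s : i != j -> j != l -> i != l ->
  k [set s_ i j s; s_ l j s; s_ l i (gen_e S)] = 2.
Proof.
move=> ij jl il; have [ji lj li] : [/\ j != i, l != j & l != i].
  by rewrite eq_sym ij eq_sym jl eq_sym il.
have [h0|] := boolP [|| i == u0, j == u0 | l == u0].
  have [sp _ _] := core_collinear s ij jl il h0; rewrite [LHS]sp.
  apply: (@two_lines_rank _ _ _ kk (core_b i) (core_b j) (core_b l));
    rewrite ?core_s_le1 ?core_b_le1 ?(free_rank3 core_b_free)//;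
    exact: core_on_line.
rewrite !negb_or => /and3P[i0 j0 l0].
have [oi oj ol] : [/\ u0 != i, u0 != j & u0 != l].
  by rewrite eq_sym i0 eq_sym j0 eq_sym l0.
have sV (x y : 'I_4) t : x != y -> s_ y x (gen_inv t) = s_ x y t by exact: dowling_eltV.
(* Only the face opposite to b1 is left. With b1 as apex, [q1] and [q2] are the elements [s] on the
   edges from [i] and [l] to it, and [z] is the element [e] on the edge from [j]. *)
apply: (@tetrahedron _ _ _ kk (core_b u0) (core_b i) (core_b j) (core_b l) _ _ _
  (s_ i u0 s) (s_ l u0 s) (s_ j u0 (gen_e S))); do ?exact: core_on_line.
- apply: le_trans core_rank4 _; apply: rank_mono => //.
  move: {ji lj li oi oj ol} ij jl il i0 j0 l0; elim/ord4_ind: i; elim/ord4_ind: j => //;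
  elim/ord4_ind: l => // *; set_tauto.
- by move=> a [[[[[[[->|->]|->]|->]|->]|->]|->]|->];
    rewrite ?core_b_le1 ?core_s_le1.
- by have [] := core_collinear s i0 ol il (orbT _).
- have [] := core_collinear (gen_inv s) oi ij oj isT.
  by rewrite !sV.
- have [] := core_collinear (gen_inv s) ol lj oj isT.
  by rewrite !sV.
Qed.

(** Adjoining [core_z] raises the rank of the whole plane 123 by 1, hence by submodularity that of
    each of its subsets; subtracting the rank of [core_z] restores the old value. *)
Lemma core_exact A : k (m false false @` A) = pdg_f A.
Proof.
pose T := range (m false false).
have T3 : h T = 3 by rewrite hm pdg_rankT.
have Tz : 4 <= h (T `|` [set core_z]).
  have := core_rank4; rewrite /k /core_rank /rank_contract z_rank1.
  set B := [set _; _; _; _] => B4.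
  have := rankU hh (T `|` [set core_z]) [set core_b u3].
  have : h [set core_b u3] <= 1 by rewrite /core_b /= hm1 pdg_b_rank1.
  have : h (B `|` [set core_z]) <= h ((T `|` [set core_z]) `|` [set core_b u3]).
    apply: rank_mono => // x [[[[->|->]|->]|->]|->].
    - by left; left; exists (bP v0).
    - by left; left; exists (bP v1).
    - by left; left; exists (bP v2).
    - by right.
    - by left; right.
  lra.
rewrite /k /core_rank /rank_contract z_rank1 -(hm false false).
apply/le_anti/andP; split.
  by have := rankU hh (m false false @` A) [set core_z]; rewrite z_rank1; lra.
have := rank_submod hh (m false false @` A `|` [set core_z]) T.
have : h (m false false @` A) <= h ((m false false @` A `|` [set core_z]) `&` T).
  by apply: rank_mono => // _ [x Ax <-]; split; [left; exists x|exists x].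
have : h (T `|` [set core_z]) <= h ((m false false @` A `|` [set core_z]) `|` T).
  by apply: rank_mono => // x [Tx|zx]; [right|left; right].
lra.
Qed.

Definition core_pdg : PDG R S 4 :=
  pdg_of_frame core_rank_fun core_b_free core_on_line core_s_le1 core_triangle.

Lemma core_extends : pdg_extends (leqnSn 3) P core_pdg.
Proof.
pose w := widen_ord (leqnSn 3).
pose gm := ground_map core_b core_c.
(* Elements of [P] are accessible only through [pdg_cover], so the embedding is chosen and then
   pinned down by the injectivity and disjointness of the labels. *)
have ex x : exists y : core_pdg,
    (exists i, x = pdg_b P i /\ y = inl (w i)) \/
    (exists (i j : 'I_3) s, [/\ (i < j)%N, x = pdg_copy P i j s &
      y = ground_copy (w i) (w j) s]).
  have [[i ->]|[i [j [s [ij ->]]]]] := pdg_cover x.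
    by exists (inl (w i)); left; exists i.
  by exists (ground_copy (w i) (w j) s); right; exists i, j, s.
have [iota iotaP] := choice ex.
have iota_b i : iota (pdg_b P i) = inl (w i).
  have [[i' [/pdg_b_inj -> //]]|[i' [j [s [ij bc _]]]]] := iotaP (pdg_b P i).
  by have := pdg_copy_b ij (esym bc).
have iota_c (i j : 'I_3) s : (i < j)%N ->
    iota (pdg_copy P i j s) = ground_copy (w i) (w j) s.
  move=> ij; have [[i' [cb _]]|[i' [j' [s' [ij' cc ->]]]]] := iotaP (pdg_copy P i j s).
    by have := pdg_copy_b ij cb.
  by have [-> -> ->] := pdg_copy_inj ij ij' cc.
have gm_iota x : gm (iota x) = m false false x.
  have [[i ->]|[i [j [s [ij ->]]]]] := pdg_cover x.
    by rewrite iota_b; elim/ord3_ind: i.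
  rewrite iota_c// ground_copyE /gm /=.
  by move: ij; elim/ord3_ind: i; elim/ord3_ind: j.
have h4 A : k (gm @` (iota @` A)) = pdg_f A.
  by rewrite -core_exact image_comp; congr (k (image _ _)); apply/funext.
have kk4 : rank_fun (fun A => k (gm @` A)) by exact: rank_fun_pullback.
have iota_inj : injective iota.
  move=> x y.
  have [[i ->]|[i [j [s [ij ->]]]]] := pdg_cover x;
    have [[i' ->]|[i' [j' [s' [ij' ->]]]]] := pdg_cover y;
    rewrite ?iota_b ?iota_c// ?ground_copyE//.
  - by move=> [/val_inj->].
  - by move=> [/val_inj-> /val_inj-> ->].
exists iota; split => //.
(* Both sides are suprema over finite subsets, because the given rank function is itself of finite
   type. *)
- move=> A; apply/le_anti/andP; split.
    apply: (finitary_le kk4) => F _ FA.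
    have -> : F = iota @` (iota @^-1` F).
      apply/seteqP; split => [y Fy|_ [x Fx <-]//].
      by have [x _ xy] := FA y Fy; exists x => //=; rewrite xy.
    rewrite h4; apply: (rank_mono (pdg_rank_fun P)) => x /FA[x' Ax'].
    by move=> /iota_inj <-.
  rewrite -(finitary_finite_type (polymatroid_finite_type (pdg_polymatroid P))).
  apply: (finitary_le (pdg_rank_fun P)) => F fF FA; rewrite -h4.
  by apply: (finitary_ge kk4); [exact: finite_image|exact: image_subset].
- move=> i j s; rewrite -val_eqE /pdg_s /dowling_elt /=.
  by case: ltngtP => // ij _; rewrite iota_c.
Qed.

End Core.

Theorem theorem6p1 (R : realType) (S : genSet) (P : PDG R S 3)
  (hP : almost_entropic (@pdg_f R S 3 P)) :
  exists Q : PDG R S 4,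
    almost_entropic (@pdg_f R S 4 Q) /\ pdg_extends (leqnSn 3) P Q.
Proof.
have [_ /closure_entropicP/two_copies] := hP.
move=> [E [h [m [ch hm m1 m2 rank5]]]].
have hh := closure_entropic_rank ch.
exists (core_pdg hh hm m1 m2 rank5); split; last exact: core_extends.
apply: almost_entropic_finitary; apply: closure_entropic_pullback.
exact: closure_entropic_contract.
Qed.
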